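(* There is an absolute numerical constant $C>0$ such that for every stochastic $K$-armed bandit ($K\ge2$) with reward distributions supported on $[0,1]$ and means $\mu_1\ge\cdots\ge\mu_K$, and every horizon $T\ge1$, the KL-MS algorithm satisfies \[ \mathrm{Reg}(T)\le C\Big(\sqrt{\dot\mu_1 KT\ln K}+K\ln T\Big),\qquad \dot\mu_1=\mu_1(1-\mu_1). \]
   Context: Bandit model: arm $i\in[K]$ has reward distribution $\nu_i$ on $[0,1]$ with mean $\mu_i$, indexed so $\mu_1\ge\cdots\ge\mu_K$. At round $t$ the learner picks $I_t$ and observes $y_t\sim\nu_{I_t}$ independently of the past given $I_t$. $N_{t,a}$ = number of pulls of arm $a$ in rounds $1..t$; $\hat\mu_{t,a}$ = empirical mean of arm $a$'s rewards up to round $t$; $\hat\mu_{t,\max}=\max_a\hat\mu_{t,a}$; $\mathrm{Reg}(T)=T\mu_1-\mathbb E\sum_{t=1}^Ty_t$. $\mathsf{kl}(p,q)=p\ln\frac pq+(1-p)\ln\frac{1-p}{1-q}$. KL-MS: for $t\le K$ pull arm $t$; for $t\ge K+1$ pull $I_t\sim p_t$ with $p_{t,a}\propto\exp(-N_{t-1,a}\,\mathsf{kl}(\hat\mu_{t-1,a},\hat\mu_{t-1,\max}))$. *)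

(* Defs.v *)
From HB Require Import structures.
From mathcomp Require Import all_boot all_order all_algebra.
From mathcomp Require Import all_classical all_reals all_analysis.
From mathcomp Require Import Rstruct Rstruct_topology.
Set Implicit Arguments. Unset Strict Implicit. Unset Printing Implicit Defensive.
Import Order.TTheory GRing.Theory Num.Theory.
Local Open Scope ring_scope.

Section KLMS.
Context {R : realType}.

Definition xlnratio (p q : R) : R := if p == 0 then 0 else p * ln (p / q).

(* Bernoulli KL divergence kl(p,q) (finite part) *)
Definition kl (p q : R) : R := xlnratio p q + xlnratio (1 - p) (1 - q).

Definition kl_infinite (p q : R) : bool :=
  ((q == 0) && (p != 0)) || ((q == 1) && (p != 1)).

Definition kl_weight (n : nat) (p q : R) : R :=
  if kl_infinite p q then 0 else expR (- (n%:R * kl p q)).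

Variable K : nat.

Definition history := seq ('I_K * R).

Definition pulls (h : history) (a : 'I_K) : nat := count (fun x => x.1 == a) h.

Definition emp_mean (h : history) (a : 'I_K) : R :=
  if pulls h a == 0%N then 0
  else (\sum_(x <- h | x.1 == a) x.2) / (pulls h a)%:R.

(* \hat mu_{t,max} (rewards lie in [0,1], so empirical means are >= 0) *)
Definition emp_max (h : history) : R := \big[Num.max/0]_(a < K) emp_mean h a.

Definition klms_weight (h : history) (a : 'I_K) : R :=
  kl_weight (pulls h a) (emp_mean h a) (emp_max h).

(* probability that KL-MS pulls arm a at round t = size h + 1, given the
   history h of the first t-1 rounds *)
Definition klms_policy (h : history) (a : 'I_K) : R :=
  if (size h < K)%N then (if nat_of_ord a == size h then 1 else 0)
  else klms_weight h a / (\sum_(b < K) klms_weight h b).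

Variable nu : 'I_K -> probability (measurableTypeR R) R.

(* expected sum of the rewards of the next n rounds, given history h
   (the law of the interaction process, written recursively) *)
Fixpoint exp_future_reward (n : nat) (h : history) : \bar R :=
  match n with
  | 0 => 0%E
  | n'.+1 => (\sum_(a < K) (klms_policy h a)%:E *
               \int[nu a]_y (y%:E + exp_future_reward n' (rcons h (a, y))))%E
  end.

Definition mean (a : 'I_K) : R := fine (\int[nu a]_y y%:E)%E.

Definition mu_best : R := \big[Num.max/0]_(a < K) mean a.

Definition klms_regret (T : nat) : \bar R :=
  ((T%:R * mu_best)%:E - exp_future_reward T [::])%E.

End KLMS.

(* Main.v *)
(* Every round is charged to explicit nonnegative supermartingales of the rewards of
   one arm, so the recursion defining the expected reward is bounded by a backward
   induction with a potential function, integrating in the last reward only.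

   Let arm a have gap d, let m = mu_1 - d/4, s = mu_1 (1 - mu_1), M = (s + d)/d^2.
   A pull of a is paid for in one of four ways: it is among its first
   u ~ 32 M ln(T/M) pulls; or its empirical mean exceeds mu_a + d/4 (Chernoff, O(M)
   in total); or hat mu_max >= m, and then it had probability at most
   exp(-u/(32 M)) <= M/T; or hat mu_max < m, and then
   p_a <= p_1 exp(N_1 kl(hat mu_1, m)).  For the last case one needs
   sum_k E[1{X_k <= m} exp(k kl(X_k, m))] = O(M) without a logarithm, X_k being the
   mean of k rewards of arm 1.  Up to a factor e, exp(k kl(., m)) is dominated by the
   maximum of the likelihood ratios of Bernoulli(q) against Bernoulli(m) over a grid
   of q of mesh ~ 1/sqrt k in the variables sqrt q and sqrt(1 - q); the i-th ratio has
   expectation at most exp(-c i sqrt(k/M)), and the double sum over i and k is O(M).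

   Summing d M (1 + ln(T/M)) over the arms with d > sqrt(s K ln K / T) yields the
   bound. *)
Require Import Defs.
From HB Require Import structures.
From mathcomp Require Import all_boot all_order all_algebra.
From mathcomp Require Import all_classical all_reals all_analysis.
From mathcomp Require Import Rstruct Rstruct_topology.
From mathcomp Require Import measurable_realfun ring lra.
Import Order.TTheory GRing.Theory Num.Theory.
Local Open Scope ring_scope.

(** * Expectations under laws on the unit interval *)

Section Expectation.
Context {R : realType} (P : probability (measurableTypeR R) R).

(* No measurability is assumed: both sides are differences of suprema over simple
   functions. *)
Lemma le_integral_any (f g : R -> \bar R) :
  (forall x, (f x <= g x)%E) -> (\int[P]_x f x <= \int[P]_x g x)%E.
Proof.
move=> fg; rewrite /integral !patch_setT.
apply: leeB; apply: ereal_sup_le => _ [h /= hu <-].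
  exists h => // x; apply: (le_trans (hu x)).
  by rewrite !funeposE ge_max !le_max fg lexx orbT.
exists h => // x; apply: (le_trans (hu x)).
by rewrite !funenegE ge_max !le_max leeN2 fg lexx orbT.
Qed.

(** Restricting to the unit interval leaves [F] free elsewhere; bundling integrability with the
    value keeps the linearity rules free of side conditions. *)
Definition has_mean (F : R -> R) (c : R) :=
  P.-integrable `[0%R, 1%R]%classic (EFin \o F) /\
  (\int[P]_(x in `[0%R, 1%R]%classic) (F x)%:E = c%:E)%E.

Hypothesis P01 : P [set x : R | 0 <= x <= 1]%classic = 1%E.

Let set01E : [set x : R | 0 <= x <= 1]%classic = `[0%R, 1%R]%classic.
Proof. by apply/seteqP; split=> x /=; rewrite in_itv. Qed.

Lemma has_mean_cst c : has_mean (fun=> c) c.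
Proof.
split.
  apply/integrableP; split; first exact: measurable_cst.
  rewrite integral_cst//= -set01E P01 mule1; exact: ltry.
by rewrite integral_cst//= -set01E P01 mule1.
Qed.

Lemma has_meanD F G c d : has_mean F c -> has_mean G d ->
  has_mean (fun x => F x + G x) (c + d).
Proof.
move=> [iF eF] [iG eG]; split.
  exact: (integrableD _ iF iG).
under eq_integral do rewrite EFinD.
by rewrite integralD_EFin// eF eG.
Qed.

Lemma has_meanZ k F c : has_mean F c -> has_mean (fun x => k * F x) (k * c).
Proof.
move=> [iF eF]; split; first exact: (integrableZl _ k iF).
under eq_integral do rewrite EFinM.
by rewrite integralZl// eF.
Qed.

Lemma has_mean_sum (I : Type) (r : seq I) (p : pred I) (F : I -> R -> R) c :
  (forall i, p i -> has_mean (F i) (c i)) ->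
  has_mean (fun x => \sum_(i <- r | p i) F i x) (\sum_(i <- r | p i) c i).
Proof.
move=> H; elim: r => [|i r IH].
  rewrite big_nil; under eq_fun do rewrite big_nil; exact: has_mean_cst.
rewrite big_cons; under eq_fun do rewrite big_cons.
by case: ifP => // pi; apply: has_meanD => //; exact: H.
Qed.

Lemma has_mean_le F G c d : (forall x, 0 <= x <= 1 -> F x <= G x) ->
  has_mean F c -> has_mean G d -> c <= d.
Proof.
move=> FG [iF eF] [iG eG]; rewrite -lee_fin -eF -eG.
apply: le_integral => //= x; rewrite inE/= in_itv/= => /FG.
by rewrite lee_fin.
Qed.

Lemma bounded_has_mean (F : R -> R) (B : R) : measurable_fun setT F ->
  (forall x, 0 <= x <= 1 -> `|F x| <= B) -> exists c, has_mean F c.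
Proof.
move=> mF FB.
have iF : P.-integrable `[0%R, 1%R]%classic (EFin \o F).
  apply: (@le_integrable _ _ _ P _ _ _ (EFin \o (fun=> B))) => //.
  - apply/measurable_EFinP; exact: measurable_funTS.
  - move=> x /=; rewrite in_itv/= => /FB h; rewrite lee_fin.
    exact: le_trans h (ler_norm _).
  - by have [] := has_mean_cst B.
exists (fine (\int[P]_(x in `[0%R, 1%R]%classic) (F x)%:E)%E); split=> //.
by rewrite fineK//; exact: integrable_fin_num.
Qed.

Lemma eq_integral_unit (f g : measurableTypeR R -> \bar R) :
  measurable_fun setT f -> measurable_fun setT g ->
  (forall x, 0 <= x <= 1 -> f x = g x) -> (\int[P]_x f x = \int[P]_x g x)%E.
Proof.
move=> mf mg fg; apply: (@ae_eq_integral _ _ _ P setT g f) => //.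
pose I : set (measurableTypeR R) := `[0%R, 1%R]%classic.
have mI : measurable I := measurable_itv _.
exists (~` I)%classic; split.
- exact: measurableC.
- by apply: (etrans (probability_setC P mI)); rewrite /I -set01E P01 subee.
- by move=> x /= h Ix; apply: h => _; apply: fg; move: Ix; rewrite /I /= in_itv.
Qed.

Lemma integral_has_mean F c : measurable_fun setT F -> has_mean F c ->
  (\int[P]_x (F x)%:E = c%:E)%E.
Proof.
move=> mF [iF <-]; rewrite [RHS]integral_mkcond.
apply: eq_integral_unit => //; first exact/measurable_EFinP.
  by apply/(measurable_restrictT _ _).1 => //; exact: measurable_int iF.
by move=> x x01; rewrite patchE mem_set//= in_itv.
Qed.

(** Meant for [g] built from the recursive expected reward, for which only a pointwise lower bound
    on the unit interval is at hand. *)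
Lemma integral_ge_has_mean F c (g : R -> \bar R) : has_mean F c ->
  (forall x, 0 <= x <= 1 -> ((F x)%:E <= g x)%E) -> (c%:E <= \int[P]_x g x)%E.
Proof.
move=> [iF eF] Fg.
pose I : set (measurableTypeR R) := `[0%R, 1%R]%classic.
have mI : measurable I := measurable_itv _.
(* The value -oo puts [f] below [g] everywhere; it is taken on a null set only, so the integral
   remains that of [F]. *)
pose f (x : measurableTypeR R) : \bar R := if x \in I then (F x)%:E else -oo%E.
pose G : measurableTypeR R -> \bar R := (EFin \o F) \_ I.
have mG : measurable_fun setT G.
  by apply/(measurable_restrictT _ _).1 => //; exact: measurable_int iF.
have IE x : (x \in I) = (0 <= x <= 1) by rewrite mem_setE in_itv.
apply: (@le_trans _ _ (\int[P]_x f x)%E); last first.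
  apply: le_integral_any => x; rewrite /f IE.
  by case: ifP => [/Fg//|_]; rewrite leNye.
rewrite -eF integral_mkcond -/G.
rewrite (@eq_integral_unit G f) //.
- have -> : f = (fun x => if x \in I then G x else -oo%E).
    by apply/funext => x; rewrite /f /G patchE; case: ifP.
  apply: measurable_fun_if => //=.
  + by apply: (measurable_fun_bool true); rewrite setTI preimage_mem_true.
  + exact: measurable_funTS.
- by move=> x x01; rewrite /f /G patchE IE x01.
Qed.

End Expectation.

(** * Bernoulli divergence *)

Section KLInequalities.
Context {R : realType}.
Implicit Types p q x y m t : R.

(** Inverting [1 - x <= expR (- x)] reduces this to (1 - x)(1 + x + 2 x^2) >= 1, that is x^2 (1 - 2
    x) >= 0. *)
Lemma expR_le_quad x : x <= 1/2 -> expR x <= 1 + x + 2 * x ^+ 2.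
Proof.
move=> x2; have h : 0 < 1 - x by lra.
have := expR_ge1Dx (- x); rewrite expRN => h1.
have : expR x <= (1 - x)^-1.
  by rewrite -(invrK (expR x)) lef_pV2 ?posrE// invr_gt0 expR_gt0.
move=> /le_trans; apply; rewrite -[leLHS]mul1r ler_pdivrMr//.
have : 0 <= x ^+ 2 * (1 - 2 * x) by apply: mulr_ge0; [exact: sqr_ge0|lra].
by rewrite !expr2 => ?; nra.
Qed.

Lemma ln_le_subr1 x : 0 < x -> ln x <= x - 1.
Proof. by move=> x0; have := @le_ln1Dx R (x - 1); rewrite subrKC; apply; lra. Qed.

(** Fenchel-Young for p ln p: [ln z <= z - 1] at z = (q / p) e^(-t). *)
Lemma xlnratio_ge p q t : 0 <= p -> 0 < q ->
  p - q * expR (- t) <= xlnratio p q + p * t.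
Proof.
move=> p0 q0; rewrite /xlnratio; case: eqP => [->|/eqP pn0].
  by rewrite mul0r addr0 sub0r oppr_le0 mulr_ge0 ?expR_ge0// ltW.
have {}p0 : 0 < p by rewrite lt_def pn0.
have e0 : 0 < q / p * expR (- t) by rewrite mulr_gt0 ?divr_gt0 ?expR_gt0.
have := ln_le_subr1 _ e0.
rewrite lnM ?posrE ?expR_gt0 ?divr_gt0// expRK !ln_div ?posrE// => h.
have : p * (ln q - ln p - t) <= p * (q / p * expR (- t) - 1) by rewrite ler_pM2l.
have -> : p * (q / p * expR (- t) - 1) = q * expR (- t) - p by field.
lra.
Qed.

(** Donsker-Varadhan lower bound with a centred linear tilt: the two outcomes get exponents -t (1 -
    q) and t q, whose mean under Bernoulli(q) is 0, so the quadratic expansion leaves only the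
    variance. *)
Lemma kl_ge_tilt p q t : 0 <= p <= 1 -> 0 < q < 1 -> -(1/2) <= t <= 1/2 ->
  t * (q - p) - 2 * t ^+ 2 * (q * (1 - q)) <= kl p q.
Proof.
move=> /andP[p0 p1] /andP[q0 q1] /andP[t0 t1].
have h1 := @xlnratio_ge p q (t * (1 - q)) p0 q0.
have : 1 - p - (1 - q) * expR (- - (t * q)) <=
    xlnratio (1 - p) (1 - q) + (1 - p) * - (t * q) by apply: xlnratio_ge; lra.
rewrite opprK /kl => h2.
have e1 : expR (- (t * (1 - q))) <= 1 + - (t * (1 - q)) + 2 * (- (t * (1 - q))) ^+ 2.
  by apply: expR_le_quad; nra.
have e2 : expR (t * q) <= 1 + (t * q) + 2 * (t * q) ^+ 2 by apply: expR_le_quad; nra.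
have E1 : q * expR (- (t * (1 - q))) <= q * (1 + - (t * (1 - q)) + 2 * (- (t * (1 - q))) ^+ 2).
  by rewrite ler_pM2l.
have E2 : (1 - q) * expR (t * q) <= (1 - q) * (1 + (t * q) + 2 * (t * q) ^+ 2).
  by rewrite ler_pM2l// subr_gt0.
have id : q * (1 + - (t * (1 - q)) + 2 * (- (t * (1 - q))) ^+ 2) +
  (1 - q) * (1 + (t * q) + 2 * (t * q) ^+ 2) = 1 + 2 * t ^+ 2 * (q * (1 - q)) by ring.
lra.
Qed.

Lemma klpp p : kl p p = 0.
Proof.
have h (x : R) : xlnratio x x = 0.
  by rewrite /xlnratio; case: eqP => // /eqP x0; rewrite divff// ln1 mulr0.
by rewrite /kl !h addr0.
Qed.

Lemma kl_ge_bernstein p q : 0 <= p -> p <= q -> q <= 1 -> ~~ kl_infinite p q ->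
  (q - p) ^+ 2 / (8 * (q * (1 - q) + (q - p))) <= kl p q.
Proof.
move=> p0 pq q1; rewrite /kl_infinite negb_or !negb_and !negbK => /andP[h0 h1].
have [<-|npq] := eqVneq p q; first by rewrite subrr expr0n mul0r klpp.
have ltpq : p < q by rewrite lt_neqAle npq.
have q0 : 0 < q by apply: le_lt_trans ltpq.
have {}q1 : q < 1.
  rewrite lt_neqAle q1 andbT; apply/eqP => qE.
  by move: h1; rewrite qE eqxx /= => /eqP pE; move: npq; rewrite pE qE eqxx.
set z := q - p; set s := q * (1 - q).
have z0 : 0 < z by rewrite subr_gt0.
have s0 : 0 < s by rewrite mulr_gt0// subr_gt0.
have sz : 0 < s + z by rewrite addr_gt0.
(* The maximiser of t z - 2 t^2 s is z / (4 s); adding z to s keeps t <= 1/4. *)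
pose t := z / (4 * (s + z)).
have t0 : 0 <= t by rewrite divr_ge0 ?mulr_ge0 ?ltW.
have t1 : t <= 1/4.
  by rewrite ler_pdivrMr ?mulr_gt0//; lra.
apply: (@le_trans _ _ (t * z - 2 * t ^+ 2 * s)); last by apply: kl_ge_tilt; lra.
have -> : t * z - 2 * t ^+ 2 * s =
   z ^+ 2 / (8 * (s + z)) + z ^+ 3 / (8 * (s + z) ^+ 2).
  by rewrite /t; field; rewrite gt_eqF.
by rewrite lerDl divr_ge0 ?mulr_ge0 ?exprn_ge0 ?ltW.
Qed.

Lemma kl_ge0 p q : 0 <= p -> p <= q -> q <= 1 -> ~~ kl_infinite p q -> 0 <= kl p q.
Proof.
move=> p0 pq q1 h; apply: le_trans (@kl_ge_bernstein p q p0 pq q1 h).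
rewrite divr_ge0 ?sqr_ge0// mulr_ge0// addr_ge0 ?subr_ge0// mulr_ge0 ?subr_ge0//.
exact: le_trans pq.
Qed.

Lemma xlnratio_le p q : 0 <= p -> 0 < q -> xlnratio p q <= p ^+ 2 / q - p.
Proof.
move=> p0 q0; rewrite /xlnratio; case: eqP => [->|/eqP pn0].
  by rewrite expr0n mul0r subr0.
have {}p0 : 0 < p by rewrite lt_def pn0.
have := ln_le_subr1 (p / q); rewrite divr_gt0// => /(_ isT) h.
rewrite -(ler_pM2l p0) in h; apply: le_trans h _.
by rewrite le_eqVlt; apply/orP; left; apply/eqP; field; rewrite gt_eqF.
Qed.

(** Bounding both logarithms by z - 1 leaves p^2 / q + (1 - p)^2 / (1 - q) - 1, the chi-square
    divergence. *)
Lemma kl_le_chi2 p q : 0 <= p <= 1 -> 0 < q < 1 ->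
  kl p q <= (p - q) ^+ 2 / (q * (1 - q)).
Proof.
move=> /andP[p0 p1] /andP[q0 q1].
have q1' : 0 < 1 - q by lra.
have h1 := @xlnratio_le p q p0 q0.
have h2 : xlnratio (1 - p) (1 - q) <= (1 - p) ^+ 2 / (1 - q) - (1 - p).
  by apply: xlnratio_le; lra.
rewrite /kl; apply: le_trans (lerD h1 h2) _.
rewrite le_eqVlt; apply/orP; left; apply/eqP; field.
by rewrite !gt_eqF.
Qed.

Lemma xlnratioE p q : 0 <= p -> 0 < q -> xlnratio p q = p * (ln p - ln q).
Proof.
move=> p0 q0; rewrite /xlnratio; case: eqP => [->|/eqP pn0]; first by rewrite mul0r.
by rewrite ln_div ?posrE// lt_def pn0.
Qed.

(** The entropy of [p] cancels, so the difference is affine in [p] and can be distributed over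
    samples with mean [p]. *)
Lemma klB p q m : 0 <= p <= 1 -> 0 < q < 1 -> 0 < m < 1 ->
  kl p m - kl p q = p * (ln q - ln m) + (1 - p) * (ln (1 - q) - ln (1 - m)).
Proof.
move=> /andP[p0 p1] /andP[q0 q1] /andP[m0 m1].
by rewrite /kl !xlnratioE ?subr_ge0 ?subr_gt0//; ring.
Qed.

Lemma lnB_ge x y : 0 < x -> 0 < y -> 1 - y / x <= ln x - ln y.
Proof.
move=> x0 y0; have := ln_le_subr1 (y / x); rewrite divr_gt0// => /(_ isT).
by rewrite ln_div ?posrE//; lra.
Qed.

Lemma kl_mono p q m : 0 <= p -> p <= q -> q <= m -> 0 < m < 1 -> kl p q <= kl p m.
Proof.
move=> p0 pq qm /andP[m0 m1].
have p1 : p <= 1 by lra.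
have [q0|q0] := leP q 0.
  have -> : q = p by lra.
  have pm : p <= m by lra.
  rewrite klpp; apply: kl_ge0 => //; first exact: ltW.
  by rewrite /kl_infinite (gt_eqF m0) (lt_eqF m1).
have q1 : q < 1 by lra.
have q1' : 0 < 1 - q by lra.
rewrite -subr_ge0 klB; [|lra..].
have h1 := @lnB_ge q m q0 m0.
have h2 : 1 - (1 - m) / (1 - q) <= ln (1 - q) - ln (1 - m) by apply: lnB_ge; lra.
have H1 := ler_wpM2l p0 h1.
have p1' : 0 <= 1 - p by lra.
have H2 := ler_wpM2l p1' h2.
apply: le_trans (lerD H1 H2).
have -> : p * (1 - m / q) + (1 - p) * (1 - (1 - m) / (1 - q)) =
   (m - q) * (q - p) / (q * (1 - q)) by field; rewrite !gt_eqF.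
by rewrite divr_ge0// mulr_ge0//; lra.
Qed.

Definition bet q m y := y * (q / m) + (1 - y) * ((1 - q) / (1 - m)).

Lemma bet_gt0 q m y : 0 < q < 1 -> 0 < m < 1 -> 0 <= y <= 1 -> 0 < bet q m y.
Proof.
move=> /andP[q0 q1] /andP[m0 m1] /andP[y0 y1].
have a0 : 0 < q / m by rewrite divr_gt0.
have b0 : 0 < (1 - q) / (1 - m) by rewrite divr_gt0// subr_gt0.
rewrite /bet; have [->|y0'] := eqVneq y 0; first by rewrite mul0r add0r subr0 mul1r.
by apply: ltr_wpDr; [rewrite mulr_ge0 ?subr_ge0// ltW|rewrite mulr_gt0// lt_def y0'].
Qed.

(** Jensen for [ln], by its tangent at the average [bet q m y]: the weighted first-order terms add
    up to 0. *)
Lemma ln_bet_ge q m y : 0 < q < 1 -> 0 < m < 1 -> 0 <= y <= 1 ->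
  y * (ln q - ln m) + (1 - y) * (ln (1 - q) - ln (1 - m)) <= ln (bet q m y).
Proof.
move=> q01 m01 y01; have B0 := bet_gt0 _ _ _ q01 m01 y01.
move: q01 m01 y01 => /andP[q0 q1] /andP[m0 m1] /andP[y0 y1].
have q1' : 0 < 1 - q by lra.
have m1' : 0 < 1 - m by lra.
have y1' : 0 <= 1 - y by lra.
have h1 := @lnB_ge _ _ B0 (divr_gt0 q0 m0).
have h2 := @lnB_ge _ _ B0 (divr_gt0 q1' m1').
rewrite !ln_div ?posrE// in h1 h2.
have H1 := ler_wpM2l y0 h1.
have H2 := ler_wpM2l y1' h2.
have : y * (1 - q / m / bet q m y) + (1 - y) * (1 - (1 - q) / (1 - m) / bet q m y) = 0.
  have -> : y * (1 - q / m / bet q m y) + (1 - y) * (1 - (1 - q) / (1 - m) / bet q m y) =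
     1 - bet q m y / bet q m y by rewrite {3}/bet; ring.
  by rewrite divff ?subrr// gt_eqF.
lra.
Qed.

(* Per sample this is concavity of [ln]: the likelihood ratio of Bernoulli q
   against Bernoulli m is below its chord [bet q m], which is affine and hence has
   an expectation depending on the reward law through its mean only. *)
Lemma expR_kl_le_bet (l : seq R) x q m : all (fun y => 0 <= y <= 1) l ->
  (size l)%:R * x = \sum_(y <- l) y -> 0 <= x <= 1 -> 0 < q < 1 -> 0 < m < 1 ->
  expR ((size l)%:R * kl x m) <=
  expR ((size l)%:R * kl x q) * \prod_(y <- l) bet q m y.
Proof.
move=> l01 lx x01 q01 m01.
have P0 : 0 < \prod_(y <- l) bet q m y.
  rewrite big_seq; apply: prodr_gt0 => y yl; apply: bet_gt0 => //.
  exact: (allP l01).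
rewrite -[X in _ <= _ * X]lnK ?posrE// -exp.expRD ler_expR -lerBlDl -mulrBr klB//.
have -> : (size l)%:R * (x * (ln q - ln m) + (1 - x) * (ln (1 - q) - ln (1 - m))) =
  \sum_(y <- l) (y * (ln q - ln m) + (1 - y) * (ln (1 - q) - ln (1 - m))).
  rewrite big_split /= -!big_distrl /= -lx sumrB -lx.
  rewrite big_const_seq count_predT iter_addr_0.
  by rewrite -[1 *+ _]mulr_natl; ring.
elim: l l01 {lx} P0 => [|y l IH]; first by rewrite !big_nil ln1.
rewrite /= !big_cons => /andP[y01 l01] P0.
have B0 := bet_gt0 _ _ _ q01 m01 y01.
have P0' : 0 < \prod_(j <- l) bet q m j by rewrite -(pmulr_rgt0 _ B0).
by rewrite lnM ?posrE// lerD ?IH// ln_bet_ge.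
Qed.

End KLInequalities.

(** * The grid of Bernoulli parameters *)

Section Grid.
Context {R : realType}.
Implicit Types b q x y m t r : R.

Lemma sum_expR_geometric y n : 0 < y ->
  \sum_(1 <= i < n) expR (- (i%:R * y)) <= (expR y - 1)^-1.
Proof.
move=> y0.
have E0 : 0 < expR y - 1 by rewrite subr_gt0 expR_gt1.
suff h k : \sum_(1 <= i < k.+1) expR (- (i%:R * y)) <=
    (expR y - 1)^-1 * (1 - expR (- (k%:R * y))).
  case: n => [|k]; first by rewrite big_geq// invr_ge0 ltW.
  apply: le_trans (h k) _; rewrite -[leRHS]mulr1 ler_wpM2l ?invr_ge0 ?(ltW E0)//.
elim: k => [|k IH]; first by rewrite big_geq// mul0r oppr0 exp.expR0 subrr mulr0.
rewrite big_nat_recr//=; apply: le_trans (lerD IH (lexx _)) _.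
rewrite -(ler_pM2l E0) mulrDr !mulrA mulfV ?gt_eqF// !mul1r.
have -> : expR (- (k%:R * y)) = expR y * expR (- (k.+1%:R * y)).
  by rewrite -exp.expRD -natr1; congr expR; ring.
by lra.
Qed.

(** The cubic term matters for [sum_inv_expR_sqrt]: at y = b sqrt k, a quadratic bound would leave
    the divergent sum of 1/k. *)
Lemma expR_ge_cubic y : 0 <= y -> 1 + y + y ^+ 2 / 3 + y ^+ 3 / 27 <= expR y.
Proof.
move=> y0.
have -> : 1 + y + y ^+ 2 / 3 + y ^+ 3 / 27 = (1 + y / 3) ^+ 3 by field.
have -> : expR y = expR (y / 3) ^+ 3.
  by rewrite -expRM_natl; congr expR; field.
by rewrite lerXn2r ?nnegrE ?expR_ge0 ?addr_ge0 ?divr_ge0// expR_ge1Dx.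
Qed.

(* The right-hand side telescopes through [(54 / b) * sqrt n / (1 + b * sqrt n)]. *)
Lemma sum_inv_expR_sqrt b n : 0 < b ->
  \sum_(1 <= k < n) (expR (b * Num.sqrt k%:R) - 1)^-1 <= 54 / b ^+ 2.
Proof.
move=> b0.
pose F (k : nat) : R := 54 / b * (Num.sqrt k%:R / (1 + b * Num.sqrt k%:R)).
have den k : 0 < 1 + b * Num.sqrt k%:R.
  by rewrite ltr_wpDr// mulr_ge0 ?sqrtr_ge0// ltW.
have Fle k : F k <= 54 / b ^+ 2.
  have -> : 54 / b ^+ 2 = 54 / b * b^-1 by field; rewrite gt_eqF.
  rewrite /F ler_wpM2l ?divr_ge0// ?(ltW b0)// ler_pdivrMr// -(ler_pM2l b0).
  by rewrite mulrA mulfV ?gt_eqF// mul1r; lra.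
have h k : \sum_(1 <= i < k.+1) (expR (b * Num.sqrt i%:R) - 1)^-1 <= F k.
  elim: k => [|k IH].
    by rewrite big_geq// /F mulr_ge0 ?divr_ge0 ?(ltW b0) ?sqrtr_ge0 ?(ltW (den _)).
  rewrite big_nat_recr//=; apply: le_trans (lerD IH (lexx _)) _.
  rewrite -lerBrDl.
  set s := Num.sqrt k.+1%:R; pose t : R := Num.sqrt k%:R.
  have s0 : 0 < s by rewrite sqrtr_gt0 ltr0n.
  have t0 : 0 <= t by rewrite sqrtr_ge0.
  have ts : t <= s by rewrite ler_wsqrtr// ler_nat.
  have st2 : s ^+ 2 = t ^+ 2 + 1 by rewrite !sqr_sqrtr ?ler0n// natr1.
  have ds : 0 < 1 + b * s := den k.+1.
  have dt : 0 < 1 + b * t := den k.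
  have y0 : 0 < b * s by rewrite mulr_gt0.
  have E0 : 0 < expR (b * s) - 1 by rewrite subr_gt0 expR_gt1.
  have -> : F k.+1 - F k = 54 * (s - t) / (b * (1 + b * s) * (1 + b * t)).
    by rewrite /F -/s -/t; field; rewrite !gt_eqF.
  have st : s - t = (s + t)^-1.
    have n0 : s + t != 0 by rewrite gt_eqF// ltr_pwDl.
    apply: (mulIf n0); rewrite mulVf//.
    have -> : (s - t) * (s + t) = s ^+ 2 - t ^+ 2 by ring.
    by rewrite st2; ring.
  (* The summand is below this value because e^y - 1 >= y (1 + y)^2 / 27, and the increment of [F]
     is above it because s - t = 1 / (s + t) >= 1 / (2 s). *)
  apply: (@le_trans _ _ (27 / (b * s * (1 + b * s) ^+ 2))); last first.
    have -> : 27 / (b * s * (1 + b * s) ^+ 2) =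
        54 * (2 * s)^-1 / (b * (1 + b * s) * (1 + b * s)).
      by field; rewrite !gt_eqF.
    rewrite st; apply: ler_pM.
    - by rewrite mulr_ge0// invr_ge0 mulr_ge0// ltW.
    - by rewrite invr_ge0 !mulr_ge0// ltW.
    - rewrite ler_pM2l// lef_pV2 ?posrE ?mulr_gt0 ?ltr_pwDl//; lra.
    - rewrite lef_pV2 ?posrE ?mulr_gt0// ler_pM2l ?mulr_gt0// lerD2l ler_pM2l//.
  rewrite -invf_div lef_pV2 ?posrE ?divr_gt0 ?mulr_gt0 ?exprn_gt0//.
  have := expR_ge_cubic _ (ltW y0); set y := b * s.
  move=> hy; rewrite ler_pdivrMr//.
  have y2 : 0 <= y ^+ 2 by apply: sqr_ge0.
  have y3 : 0 <= y ^+ 3 by rewrite exprn_ge0// ltW.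
  have -> : y * (1 + y) ^+ 2 = y + 2 * y ^+ 2 + y ^+ 3 by ring.
  have := ltW y0; rewrite -/y; lra.
case: n => [|k]; last exact: le_trans (h k) (Fle k).
by rewrite big_geq// divr_ge0// sqr_ge0.
Qed.

(** The factor 16 makes 64 k (step k)^2 = 1/4, so rounding to the grid changes k times the
    divergence by less than 1. *)
Definition step (k : nat) : R := (16 * Num.sqrt k%:R)^-1.

Lemma step_gt0 k : (0 < k)%N -> 0 < step k.
Proof. by move=> k0; rewrite invr_gt0 mulr_gt0// sqrtr_gt0 ltr0n. Qed.

Lemma step_sqr k : (0 < k)%N -> k%:R * step k ^+ 2 = 256^-1.
Proof.
move=> k0; have kn : (k%:R : R) != 0 by rewrite pnatr_eq0 -lt0n.
by rewrite /step exprVn exprMn sqr_sqrtr//; field.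
Qed.

Definition grid_sqrt m k i : R := Num.sqrt m - i%:R * step k.
Definition grid_sqrtC m k i : R := Num.sqrt (1 - m) + i%:R * step k.

(* [true] is the grid equally spaced in [sqrt q], used for [q] far from 1, and
   [false] the one equally spaced in [sqrt (1 - q)], for [q] far from 0. *)
Definition grid_point m k i (d : bool) : R :=
  if d then grid_sqrt m k i ^+ 2 else 1 - grid_sqrtC m k i ^+ 2.
Definition grid_ok m k i (d : bool) :=
  if d then 0 < grid_sqrt m k i else grid_sqrtC m k i < 1.

(** Makes the grid finite, as i < 16 sqrt k <= 16 k. The crude range is harmless: the geometric sum
    over i is bounded uniformly in its length. *)
Lemma step_index_le k i : (0 < k)%N -> i%:R * step k < 1 -> (i <= 16 * k)%N.
Proof.
move=> k0; rewrite /step ltr_pdivrMr ?mulr_gt0 ?sqrtr_gt0 ?ltr0n// mul1r => h.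
rewrite -(ler_nat R) natrM; apply: le_trans (ltW h) _.
rewrite ler_pM2l// -[leRHS]sqr_sqrtr// expr2 -[leLHS]mulr1.
rewrite ler_wpM2l ?sqrtr_ge0// -[leLHS]sqrtr1 ler_wsqrtr// ler1n//.
Qed.

Lemma truncn_step t r : 0 <= t -> 0 < r ->
  (Num.truncn (t / r))%:R * r <= t /\ t < (Num.truncn (t / r)).+1%:R * r.
Proof.
move=> t0 r0; have /andP[h1 h2] := truncn_itv (divr_ge0 t0 (ltW r0)).
by rewrite -ler_pdivlMr// -ltr_pdivrMr.
Qed.

Lemma klC p q : kl (1 - p) (1 - q) = kl p q.
Proof. by rewrite /kl !subKr addrC. Qed.

(** In square-root coordinates the chi-square bound is uniform down to 0: (s + t)^2 <= 4 s^2 cancels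
    the factor s^2 of the variance, while 1 - s^2 >= 1/4. *)
Lemma kl_sqr_close s t r : 0 <= t -> t ^+ 2 <= 1/2 -> t <= s -> s <= t + 2 * r ->
  0 < s -> r <= 16^-1 ->
  s ^+ 2 < 1 /\ kl (t ^+ 2) (s ^+ 2) <= 64 * r ^+ 2.
Proof.
move=> t0 t2 ts str s0 r16.
have t57 : t <= 5/7.
  rewrite -ler_sqr; first by apply: le_trans t2 _; lra.
    by rewrite nnegrE.
  by rewrite nnegrE; lra.
have s67 : s <= 6/7 by lra.
have s34 : s ^+ 2 <= 3/4.
  apply: (@le_trans _ _ ((6/7) ^+ 2)); last by lra.
  by rewrite ler_sqr//; rewrite nnegrE; lra.
have sp : 0 < s ^+ 2 by rewrite exprn_gt0.
have s1 : s ^+ 2 < 1 by lra.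
have q1 : 0 < 1 - s ^+ 2 by lra.
split => //.
apply: (@le_trans _ _ ((t ^+ 2 - s ^+ 2) ^+ 2 / (s ^+ 2 * (1 - s ^+ 2)))).
  apply: kl_le_chi2; first by rewrite sqr_ge0; lra.
  by rewrite sp.
rewrite ler_pdivrMr ?mulr_gt0//.
have -> : (t ^+ 2 - s ^+ 2) ^+ 2 = (s - t) ^+ 2 * (s + t) ^+ 2 by ring.
have a1 : (s - t) ^+ 2 <= (2 * r) ^+ 2.
  by clear - str ts; rewrite ler_sqr ?nnegrE; lra.
have a2 : (s + t) ^+ 2 <= (2 * s) ^+ 2.
  by clear - t0 s0 ts; rewrite ler_sqr ?nnegrE; lra.
apply: le_trans (ler_pM (sqr_ge0 _) (sqr_ge0 _) a1 a2) _.
have -> : (2 * r) ^+ 2 * (2 * s) ^+ 2 = 16 * r ^+ 2 * s ^+ 2 by ring.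
have -> : 64 * r ^+ 2 * (s ^+ 2 * (1 - s ^+ 2)) =
   16 * r ^+ 2 * s ^+ 2 * ((1 - s ^+ 2) / (1/4)) by field.
have c0 : 0 <= 16 * r ^+ 2 * s ^+ 2.
  by apply: mulr_ge0; [apply: mulr_ge0; [|exact: sqr_ge0]|exact: sqr_ge0].
apply: (ler_peMr c0).
by rewrite ler_pdivlMr//; lra.
Qed.

Lemma grid_approx m x k : 0 < m < 1 -> 0 <= x <= m -> (0 < k)%N ->
  exists q, [/\ 0 < q < 1, k%:R * kl x q <= 1 &
    q = m \/ exists i d,
      [/\ (0 < i <= 16 * k)%N, grid_ok m k i d & q = grid_point m k i d]].
Proof.
move=> /andP[m0 m1] /andP[x0 xm] k0.
have r0 := step_gt0 k k0; have rk := step_sqr k k0; set r := step k in r0 rk *.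
have r16 : r <= 16^-1.
  have : r ^+ 2 <= (16^-1) ^+ 2.
    have -> : (16^-1 : R) ^+ 2 = 256^-1 by field.
    by rewrite -rk ler_peMl ?sqr_ge0// ler1n.
  by rewrite ler_sqr// nnegrE ?invr_ge0// ltW.
have close y (h : y <= 64 * r ^+ 2) : k%:R * y <= 1.
  apply: le_trans (ler_wpM2l (ler0n _ k) h) _.
  by rewrite mulrCA rk; lra.
have x1 : x <= 1 by lra.
have [x2|x2] := leP x (1/2).
- have ts0 : Num.sqrt x <= Num.sqrt m by rewrite ler_wsqrtr.
  have s01 : Num.sqrt m < 1 by rewrite -[ltRHS]sqrtr1 ltr_sqrt.
  have t0 : 0 <= Num.sqrt x by rewrite sqrtr_ge0.
  have sm : Num.sqrt m ^+ 2 = m by rewrite sqr_sqrtr// ltW.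
  have s0p : 0 < Num.sqrt m by rewrite sqrtr_gt0.
  have tx : Num.sqrt x ^+ 2 = x by rewrite sqr_sqrtr.
  have st0 : 0 <= Num.sqrt m - Num.sqrt x by rewrite subr_ge0.
  have [h1 h2] := truncn_step _ _ st0 r0; set j := Num.truncn _ in h1 h2.
  (* One index less than the rounding of sqrt x keeps the point positive even at x = 0; index 0 is
     [m] itself. *)
  have [ts st sp] : [/\ Num.sqrt x <= grid_sqrt m k j.-1,
      grid_sqrt m k j.-1 <= Num.sqrt x + 2 * r & 0 < grid_sqrt m k j.-1].
    rewrite /grid_sqrt -/r; clear - h1 h2 r0 s0p t0 ts0.
    move: h1 h2; case: (j) => [|i] h1 h2 /=.
      by rewrite mul0r subr0; split => //; lra.
    by split; lra.
  have t2 : Num.sqrt x ^+ 2 <= 1/2 by rewrite tx.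
  have [s2 kl1] := kl_sqr_close _ _ _ t0 t2 ts st sp r16.
  rewrite tx in kl1.
  exists (grid_sqrt m k j.-1 ^+ 2); split; [by rewrite exprn_gt0| exact: close |].
  have [i0|i0] := posnP j.-1.
    by left; rewrite /grid_sqrt i0 mul0r subr0.
  right; exists j.-1, true; split => //.
  rewrite i0 (@step_index_le k)// -/r; clear - sp s01.
  by rewrite /grid_sqrt -/r in sp; lra.
- have w0 : 0 <= Num.sqrt (1 - m) by rewrite sqrtr_ge0.
  have wv : Num.sqrt (1 - m) <= Num.sqrt (1 - x) by rewrite ler_wsqrtr//; lra.
  have vx : Num.sqrt (1 - x) ^+ 2 = 1 - x by rewrite sqr_sqrtr//; lra.
  have vw0 : 0 <= Num.sqrt (1 - x) - Num.sqrt (1 - m) by rewrite subr_ge0.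
  have v0 : 0 <= Num.sqrt (1 - x) by rewrite sqrtr_ge0.
  have [h1 h2] := truncn_step _ _ vw0 r0; set j := Num.truncn _ in h1 h2.
  (* One index more than the rounding puts sqrt (1 - q) above sqrt (1 - x), the order that
     [kl_sqr_close] asks for after exchanging the two outcomes by [klC]. *)
  have [ts st sp] : [/\ Num.sqrt (1 - x) <= grid_sqrtC m k j.+1,
      grid_sqrtC m k j.+1 <= Num.sqrt (1 - x) + 2 * r & 0 < grid_sqrtC m k j.+1].
    by rewrite /grid_sqrtC -/r; clear - h1 h2 r0 v0; split; lra.
  have v2 : Num.sqrt (1 - x) ^+ 2 <= 1/2 by rewrite vx; clear - x2; lra.
  have [s2 kl1] := kl_sqr_close _ _ _ v0 v2 ts st sp r16.
  rewrite vx -(subKr 1 (grid_sqrtC _ _ _ ^+ 2)) klC in kl1.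
  have sp2 : 0 < grid_sqrtC m k j.+1 ^+ 2 by rewrite exprn_gt0.
  have s1 : grid_sqrtC m k j.+1 < 1 by rewrite -(@expr_lt1 _ 2)// ltW.
  exists (1 - grid_sqrtC m k j.+1 ^+ 2); split; [|exact: close|].
    by clear - sp2 s2; apply/andP; split; lra.
  right; exists j.+1, false; split => //.
  rewrite /= (@step_index_le k)// -/r; clear - w0 s1.
  by rewrite /grid_sqrtC -/r in s1; lra.
Qed.

End Grid.

(** * Potentials for the KL-MS process *)

Lemma sum_policy {R : realType} {n : nat} (p : 'I_n -> R) (a b : 'I_n) (x y z : R) :
  \sum_i p i = 1 ->
  \sum_i p i * (x + (i == a)%:R * y + (i == b)%:R * z) = x + p a * y + p b * z.
Proof.
move=> p1.
have h (c : 'I_n) (t : R) : \sum_i p i * ((i == c)%:R * t) = p c * t.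
  rewrite (bigD1 c)//= eqxx mul1r big1 ?addr0// => i /negPf->.
  by rewrite mul0r mulr0.
under eq_bigr do rewrite !mulrDr.
by rewrite !big_split /= !h -mulr_suml p1 mul1r.
Qed.

Section Bandit.
Context {R : realType} {K : nat}.
Implicit Types (h : history (R := R) K) (a b : 'I_K) (l : seq R).

Definition unit_seq l := all (fun y => 0 <= y <= 1) l.
Definition rewards h a : seq R := [seq z.2 | z <- h & z.1 == a].
Definition unit_history h := all (fun z => 0 <= z.2 <= 1) h.

Lemma size_rewards h a : size (rewards h a) = pulls h a.
Proof. by rewrite size_map size_filter. Qed.

Lemma rewards_rcons h b y a :
  rewards (rcons h (b, y)) a = if b == a then rcons (rewards h a) y else rewards h a.
Proof.
by rewrite /rewards filter_rcons /=; case: ifP => //; rewrite map_rcons.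
Qed.

Lemma pulls_rcons h b y a : pulls (rcons h (b, y)) a = (pulls h a + (b == a))%N.
Proof. by rewrite /pulls -cats1 count_cat /= addn0. Qed.

Lemma pulls_le h a : (pulls h a <= size h)%N.
Proof. exact: count_size. Qed.

Lemma unit_rewards h a : unit_history h -> unit_seq (rewards h a).
Proof.
move=> /allP hh; apply/allP => y /mapP[z]; rewrite mem_filter => /andP[_ /hh z01] ->.
exact: z01.
Qed.

Lemma emp_mean_sum h a :
  (size (rewards h a))%:R * emp_mean h a = \sum_(y <- rewards h a) y.
Proof.
rewrite /rewards big_map big_filter size_map size_filter /emp_mean -/(pulls h a).
have [p0|p0] := eqVneq (pulls h a) 0%N; last by rewrite mulrC divfK// pnatr_eq0.
rewrite p0 mul0r -big_filter; suff -> : [seq z <- h | z.1 == a] = [::] by rewrite big_nil.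
by apply/eqP; rewrite -size_eq0 size_filter -/(pulls h a) p0.
Qed.

Lemma unit_seq_sum l : unit_seq l -> 0 <= \sum_(y <- l) y <= (size l)%:R.
Proof.
elim: l => [|y l IH] /=; first by rewrite big_nil lexx.
move=> /andP[/andP[y0 y1] /IH/andP[s0 s1]]; rewrite big_cons -natr1.
by apply/andP; split; lra.
Qed.

Lemma emp_mean_itv h a : unit_history h -> 0 <= emp_mean h a <= 1.
Proof.
move=> hh; have := unit_seq_sum _ (unit_rewards h a hh).
rewrite -emp_mean_sum; have [/eqP|p0] := posnP (size (rewards h a)).
  by rewrite size_rewards /emp_mean => ->; rewrite lexx ler01.
have n0 : (0 : R) < (size (rewards h a))%:R by rewrite ltr0n.
by rewrite pmulr_rge0// -{2}[(size _)%:R]mulr1 ler_pM2l.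
Qed.

Lemma emp_mean_le_max h a : emp_mean h a <= emp_max h.
Proof. exact: le_bigmax. Qed.

Lemma emp_max_attained h : (0 < K)%N -> unit_history h -> exists a, emp_max h = emp_mean h a.
Proof.
move=> K0 hh; exists [arg max_(i > Ordinal K0) emp_mean h i]%O.
by apply: bigmax_eq_arg => // i _; have /andP[] := emp_mean_itv h i hh.
Qed.

Lemma kl_infinitepp (p : R) : kl_infinite p p = false.
Proof. by rewrite /kl_infinite !andbN. Qed.

Lemma klms_weight_itv h a : (0 < K)%N -> unit_history h -> 0 <= klms_weight h a <= 1.
Proof.
move=> K0 hh; rewrite /klms_weight /kl_weight; case: ifPn => fin; first by rewrite lexx ler01.
rewrite expR_ge0 /= expR_le1 oppr_le0 mulr_ge0//.
have /andP[m0 m1] := emp_mean_itv h a hh.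
apply: kl_ge0 => //; first exact: emp_mean_le_max.
by have [b ->] := emp_max_attained h K0 hh; have /andP[] := emp_mean_itv h b hh.
Qed.

(** An arm attaining the empirical maximum has weight 1. *)
Lemma klms_weight_sum_ge1 h : (0 < K)%N -> unit_history h -> 1 <= \sum_b klms_weight h b.
Proof.
move=> K0 hh; have [a ea] := emp_max_attained h K0 hh.
rewrite (bigD1 a)//= {1}/klms_weight ea /kl_weight kl_infinitepp klpp mulr0 oppr0 exp.expR0.
rewrite lerDl sumr_ge0// => b _; by have /andP[] := klms_weight_itv h b K0 hh.
Qed.

Lemma klms_policy_ge0 h a : (0 < K)%N -> unit_history h -> 0 <= klms_policy h a.
Proof.
move=> K0 hh; rewrite /klms_policy; case: ifP => _; first by case: ifP.
have W1 := klms_weight_sum_ge1 h K0 hh; have /andP[w0 _] := klms_weight_itv h a K0 hh.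
by rewrite divr_ge0// (le_trans ler01).
Qed.

Lemma klms_policy_sum h : (0 < K)%N -> unit_history h -> \sum_a klms_policy h a = 1.
Proof.
move=> K0 hh; rewrite /klms_policy; case: ltnP => [hK|_].
  rewrite (bigD1 (Ordinal hK))//= eqxx big1 ?addr0// => a.
  by rewrite -val_eqE /= => /negPf ->.
rewrite -mulr_suml divff// gt_eqF//.
by apply: lt_le_trans (klms_weight_sum_ge1 h K0 hh).
Qed.

Variable nu : 'I_K -> probability (measurableTypeR R) R.
Hypothesis nu01 : forall a, nu a [set x : R | 0 <= x <= 1]%classic = 1%E.
Hypothesis K0 : (0 < K)%N.

Lemma has_mean_mean a : has_mean (nu a) id (mean nu a).
Proof.
have [||c [ic ec]] := @bounded_has_mean R (nu a) (nu01 a) id 1.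
- exact: measurable_id.
- by move=> x /andP[x0 x1]; rewrite ger0_norm.
split => //; rewrite /mean.
by rewrite (integral_has_mean _ (nu01 a) id c) ?ec//; exact: measurable_id.
Qed.

Lemma mean_itv a : 0 <= mean nu a <= 1.
Proof.
apply/andP; split.
  apply: (has_mean_le (nu a) _ _ _ _ _ (has_mean_cst _ (nu01 a) 0) (has_mean_mean a)).
  by move=> x /andP[].
apply: (has_mean_le (nu a) _ _ _ _ _ (has_mean_mean a) (has_mean_cst _ (nu01 a) 1)).
by move=> x /andP[].
Qed.

(* [F n h] bounds the expected cost of the [n] rounds that follow [h], where a
   pull of [b] costs [c b]. *)
Definition potential (T : nat) (c : 'I_K -> R) (F : nat -> history (R := R) K -> R) :=
  (forall h, unit_history h -> 0 <= F 0%N h) /\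
  forall n h, unit_history h -> (size h + n.+1)%N = T ->
    exists2 m : 'I_K -> R,
      forall b, has_mean (nu b) (fun y => F n (rcons h (b, y))) (m b) &
      \sum_b klms_policy h b * (c b + m b) <= F n.+1 h.

(** Nothing is known of [F i] at weight 0, where it may fail to have a mean; this lets arms of small
    gap be given an arbitrary [F i]. *)
Lemma potential_sum T (I : finType) (c : I -> 'I_K -> R) F (w : I -> R) :
  (forall i, 0 <= w i) -> (forall i, 0 < w i -> potential T (c i) (F i)) ->
  potential T (fun b => \sum_i w i * c i b) (fun n h => \sum_i w i * F i n h).
Proof.
move=> w0 H; split=> [h hh|n h hh hT].
  apply: sumr_ge0 => i _; have [->|wi] := eqVneq (w i) 0; first by rewrite mul0r.
  have {}wi : 0 < w i by rewrite lt_def wi w0.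
  by rewrite mulr_ge0//; have [+ _] := H i wi; exact.
have /choice[m mP] : forall i, exists m : 'I_K -> R,
    (forall b, has_mean (nu b) (fun y => w i * F i n (rcons h (b, y))) (w i * m b)) /\
    w i * (\sum_b klms_policy h b * (c i b + m b)) <= w i * F i n.+1 h.
  move=> i; have [->|wi] := eqVneq (w i) 0.
    exists (fun=> 0); rewrite !mul0r; split => // b.
    by under eq_fun do rewrite mul0r; exact: has_mean_cst.
  have {}wi : 0 < w i by rewrite lt_def wi w0.
  have [_ /(_ n h hh hT)[m m1 m2]] := H i wi.
  exists m; split; last by rewrite ler_pM2l.
  by move=> b; apply: has_meanZ; exact: m1.
exists (fun b => \sum_i w i * m i b).
  by move=> b; apply: has_mean_sum => // i _; have [+ _] := mP i; exact.
apply: le_trans (ler_sum _ (fun i _ => (mP i).2)).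
rewrite le_eqVlt; apply/orP; left; apply/eqP.
under [RHS]eq_bigr do rewrite mulr_sumr.
rewrite exchange_big /=; apply: eq_bigr => b _.
rewrite -big_split /= mulr_sumr; apply: eq_bigr => i _; ring.
Qed.

(** Backward induction: the induction hypothesis bounds the integrand below by y plus a constant
    minus [F n], whose mean the potential provides. *)
Lemma exp_future_reward_ge T F n h : potential T (fun b => mu_best nu - mean nu b) F ->
  unit_history h -> (size h + n)%N = T ->
  ((n%:R * mu_best nu - F n h)%:E <= exp_future_reward nu n h)%E.
Proof.
move=> [F0 FS]; elim: n h => [|n IH] h hh hT /=.
  by rewrite mul0r sub0r lee_fin oppr_le0 F0.
have [m mE mle] := FS n h hh hT.
have step b : (((mean nu b + n%:R * mu_best nu) - m b)%:E <=
    \int[nu b]_y (y%:E + exp_future_reward nu n (rcons h (b, y))))%E.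
  pose G y := (y + n%:R * mu_best nu) + (-1) * F n (rcons h (b, y)).
  apply: (integral_ge_has_mean _ (nu01 b) G).
    rewrite -[- m b]mulN1r; apply: has_meanD; last exact: has_meanZ.
    apply: has_meanD; [exact: has_mean_mean|exact: has_mean_cst].
  move=> y y01; rewrite /G -addrA EFinD leeD2l// mulN1r.
  apply: IH; last by rewrite size_rcons addSnnS.
  by rewrite /unit_history all_rcons /= y01.
apply: (@le_trans _ _ (\sum_b (klms_policy h b)%:E *
    ((mean nu b + n%:R * mu_best nu) - m b)%:E)%E); last first.
  by apply: lee_sum => b _; apply: lee_wpmul2l => //; rewrite lee_fin klms_policy_ge0.
rewrite sumEFin lee_fin.
have -> : \sum_(i < K) klms_policy h i * (mean nu i + n%:R * mu_best nu - m i) =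
  n.+1%:R * mu_best nu - \sum_i klms_policy h i * (mu_best nu - mean nu i + m i).
  have -> : n.+1%:R * mu_best nu = \sum_i klms_policy h i * (n.+1%:R * mu_best nu).
    by rewrite -mulr_suml klms_policy_sum// mul1r.
  rewrite -sumrB.
  by apply: eq_bigr => i _; rewrite -natr1; ring.
by rewrite lerD2l lerN2.
Qed.

(* [B] of the rewards of [b] so far pays [cost] for the next pull of [b] out of its
   expected decrease. *)
Definition budget b (B cost : seq R -> R) :=
  (forall l, unit_seq l -> 0 <= B l) /\ (forall l, unit_seq l -> 0 <= cost l) /\
  forall l, unit_seq l -> has_mean (nu b) (fun y => B (rcons l y)) (B l - cost l).

Lemma budget_sum b (I : Type) (r : seq I) (p : pred I) (B cost : I -> seq R -> R) :
  (forall i, p i -> budget b (B i) (cost i)) ->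
  budget b (fun l => \sum_(i <- r | p i) B i l) (fun l => \sum_(i <- r | p i) cost i l).
Proof.
move=> H; split; [|split] => l l01.
- by apply: sumr_ge0 => i /H[h _]; exact: h.
- by apply: sumr_ge0 => i /H[_ [h _]]; exact: h.
- rewrite -sumrB; apply: has_mean_sum => // i /H[_ [_ h]]; exact: h.
Qed.

Lemma budgetD b B1 c1 B2 c2 : budget b B1 c1 -> budget b B2 c2 ->
  budget b (fun l => B1 l + B2 l) (fun l => c1 l + c2 l).
Proof.
move=> [p1 [q1 r1]] [p2 [q2 r2]]; split; [|split] => l l01.
- by rewrite addr_ge0 ?p1 ?p2.
- by rewrite addr_ge0 ?q1 ?q2.
- by rewrite opprD addrACA; apply: has_meanD; [exact: r1|exact: r2].
Qed.

Lemma budgetZ b k B c : 0 <= k -> budget b B c ->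
  budget b (fun l => k * B l) (fun l => k * c l).
Proof.
move=> k0 [p1 [q1 r1]]; split; [|split] => l l01.
- by rewrite mulr_ge0 ?p1.
- by rewrite mulr_ge0 ?q1.
- by rewrite -mulrBr; apply: has_meanZ; exact: r1.
Qed.

(* The conditional expectation, given the rewards [l], of the product of [f] over the
   first [k] rewards, [rho] being the mean of [f]; it drops to 0 at the next pull. *)
Definition oneshot (f : R -> R) (rho : R) (k : nat) l :=
  if (size l <= k)%N then (\prod_(y <- l) f y) * rho ^+ (k - size l) else 0.

Definition oneshot_cost (f : R -> R) (k : nat) l :=
  if size l == k then \prod_(y <- l) f y else 0.

Lemma oneshot_budget b f rho k : has_mean (nu b) f rho ->
  (forall y, 0 <= y <= 1 -> 0 <= f y) ->
  budget b (oneshot f rho k) (oneshot_cost f k).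
Proof.
move=> fr f0.
have r0 : 0 <= rho.
  exact: (has_mean_le (nu b) _ _ _ _ f0 (has_mean_cst _ (nu01 b) 0) fr).
have P0 l : unit_seq l -> 0 <= \prod_(y <- l) f y.
  by move=> /allP l01; rewrite big_seq prodr_ge0// => y /l01 /f0.
split; [|split] => l l01.
- by rewrite /oneshot; case: ifP => // _; rewrite mulr_ge0 ?P0 ?exprn_ge0.
- by rewrite /oneshot_cost; case: ifP => // _; rewrite P0.
rewrite /oneshot /oneshot_cost; under eq_fun do rewrite size_rcons.
(* Beyond k rewards everything is 0; at k the whole product is paid out; before k the value is a
   martingale. *)
case: (ltngtP (size l) k) => lk; last 2 first.
- by rewrite subr0; exact: has_mean_cst.
- by rewrite lk subnn expr0 mulr1 subrr; exact: has_mean_cst.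
pose w : R := (\prod_(y <- l) f y) * rho ^+ (k - (size l).+1).
have -> : (fun y => \prod_(z <- rcons l y) f z * rho ^+ (k - (size l).+1)) =
    (fun y => w * f y).
  by apply/funext => y; rewrite big_rcons /w /=; ring.
rewrite subr0 -(subnSK lk) exprSr mulrA; exact: has_meanZ.
Qed.

(** In order: the forced pull of [a] if still ahead, the remaining pulls among its first [u]
    (truncated subtraction), a probability [q] per remaining round, and the budgets of the rewards
    of [a] and of [i0]. *)
Definition arm_potential (a i0 : 'I_K) (u : nat) (q : R) (B3 B4 : seq R -> R) n h : R :=
  (size h <= a)%:R + (u - pulls h a)%:R + n%:R * q + B3 (rewards h a) + B4 (rewards h i0).

Lemma arm_potentialP T a i0 u q B3 B4 c3 c4 : 0 <= q ->
  budget a B3 c3 -> budget i0 B4 c4 ->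
  (forall h, unit_history h -> (K <= size h < T)%N ->
    klms_policy h a <= klms_policy h a * (pulls h a < u)%:R + q +
      klms_policy h a * c3 (rewards h a) + klms_policy h i0 * c4 (rewards h i0)) ->
  potential T (fun b => (b == a)%:R) (arm_potential a i0 u q B3 B4).
Proof.
move=> q0 [B30 [c30 H3]] [B40 [c40 H4]] key; split=> [h hh|n h hh hT].
  by rewrite /arm_potential mul0r addr0 !addr_ge0 ?B30 ?B40//; exact: unit_rewards.
have r3 := unit_rewards h a hh; have r4 := unit_rewards h i0 hh.
(* The potential after a round that pulls neither arm: the history is one longer, hence the strict
   inequality. *)
pose x := (size h < a)%:R + (u - pulls h a)%:R + n%:R * q +
  B3 (rewards h a) + B4 (rewards h i0) : R.
exists (fun b => x + (b == a)%:R * (- (pulls h a < u)%:R - c3 (rewards h a)) +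
    (b == i0)%:R * (- c4 (rewards h i0))).
  move=> b; rewrite /arm_potential.
  under eq_fun do rewrite size_rcons pulls_rcons !rewards_rcons.
  have -> : x + (b == a)%:R * (- (pulls h a < u)%:R - c3 (rewards h a)) +
      (b == i0)%:R * (- c4 (rewards h i0)) =
    ((size h < a)%:R + (u - (pulls h a + (b == a)))%:R + n%:R * q) +
     (B3 (rewards h a) - (b == a)%:R * c3 (rewards h a)) +
     (B4 (rewards h i0) - (b == i0)%:R * c4 (rewards h i0)).
    have -> : ((u - (pulls h a + (b == a)))%:R : R) =
       (u - pulls h a)%:R - (b == a)%:R * (pulls h a < u)%:R.
      case: (b == a); rewrite /= ?addn0 ?mul0r ?subr0//.
      by rewrite addn1 mul1r; case: ltnP => pu; rewrite ?subr0 ?subnS;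
        [rewrite -subn1 natrB// subn_gt0|rewrite (eqP pu)].
    by rewrite /x; ring.
  apply: has_meanD; [apply: has_meanD; first exact: has_mean_cst|].
    case: eqP => [->|_]; first by rewrite mul1r; exact: H3.
    by rewrite mul0r subr0; exact: has_mean_cst.
  case: eqP => [->|_]; first by rewrite mul1r; exact: H4.
  by rewrite mul0r subr0; exact: has_mean_cst.
under eq_bigr => b _.
  have -> : (b == a)%:R + (x + (b == a)%:R * (- (pulls h a < u)%:R - c3 (rewards h a)) +
    (b == i0)%:R * - c4 (rewards h i0)) =
    x + (b == a)%:R * (1 - (pulls h a < u)%:R - c3 (rewards h a)) +
    (b == i0)%:R * - c4 (rewards h i0) by ring.
  over.
rewrite sum_policy ?klms_policy_sum// /x /arm_potential -natr1.
have p1 := klms_policy_ge0 h a K0 hh; have p2 := klms_policy_ge0 h i0 K0 hh.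
have c3' := c30 _ r3; have c4' := c40 _ r4.
have pc3 := mulr_ge0 p1 c3'; have pc4 := mulr_ge0 p2 c4'.
have pu := mulr_ge0 p1 (ler0n R (pulls h a < u)).
set I1 := (size h < a)%:R; set I2 := (size h <= a)%:R.
suff : I1 + klms_policy h a <= I2 + klms_policy h a * (pulls h a < u)%:R + q +
    klms_policy h a * c3 (rewards h a) + klms_policy h i0 * c4 (rewards h i0).
  clear; move: ((pulls h a < u)%:R) ((u - pulls h a)%:R) => y w.
  move: I1 I2 (n%:R) (B3 _) (B4 _) (c3 _) (c4 _) (klms_policy h a) (klms_policy h i0).
  move=> I1 I2 N b3 b4 d3 d4 pa pi; lra.
have [hK|hK] := ltnP (size h) K; last first.
  have := key h hh; rewrite hK -hT -addSnnS leq_addr => /(_ isT) key'.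
  have I12 : I1 <= I2 by rewrite ler_nat; case: ltngtP.
  by rewrite -!addrA lerD// !addrA.
(* In the initial phase the pull is deterministic and is paid for by the drop of the first
   indicator. *)
have pa : klms_policy h a = (nat_of_ord a == size h)%:R.
  by rewrite /klms_policy hK; case: eqP.
have I12 : I1 + klms_policy h a <= I2.
  by rewrite pa -natrD ler_nat; case: ltngtP.
by rewrite -!addrA (le_trans I12)// lerDl !addr_ge0.
Qed.

End Bandit.

(** * Budgets of a single arm *)

Section ArmBudgets.
Context {R : realType} {K : nat}.
Variable nu : 'I_K -> probability (measurableTypeR R) R.
Hypothesis nu01 : forall a, nu a [set x : R | 0 <= x <= 1]%classic = 1%E.

Lemma has_mean_affine b (c d : R) : has_mean (nu b) (fun y => c + d * y) (c + d * mean nu b).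
Proof.
apply: has_meanD; first exact: has_mean_cst.
by apply: has_meanZ; exact: has_mean_mean.
Qed.

(** On the unit interval y^2 <= y turns the quadratic bound of the exponential into an affine one,
    so the mean alone matters and the Bernoulli variance appears. *)
Lemma has_mean_expR b (t : R) : -(1/2) <= t <= 1/2 ->
  exists2 rho, has_mean (nu b) (fun y => expR (t * (y - mean nu b))) rho &
    rho <= expR (2 * t ^+ 2 * (mean nu b * (1 - mean nu b))).
Proof.
move=> /andP[t0 t1]; set mu := mean nu b.
have /andP[mu0 mu1] : 0 <= mu <= 1 by exact: mean_itv.
have quad y : 0 <= y <= 1 -> expR (t * (y - mu)) <=
    (1 - t * mu + 2 * t ^+ 2 * mu ^+ 2) + (t + 2 * t ^+ 2 * (1 - 2 * mu)) * y.
  move=> /andP[y0 y1].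
  have ty : t * (y - mu) <= 1/2.
    apply: le_trans (ler_norm _) _; rewrite normrM.
    have a1 : `|t| <= 1/2 by rewrite ler_norml t0.
    have a2 : `|y - mu| <= 1 by rewrite ler_norml; apply/andP; split; lra.
    by rewrite -[leRHS]mulr1; apply: ler_pM.
  apply: le_trans (expR_le_quad _ ty) _.
  have : 0 <= t ^+ 2 * (y * (1 - y)) by rewrite mulr_ge0 ?sqr_ge0// mulr_ge0// subr_ge0.
  by clear; rewrite !expr2; nra.
have [||rho hr] := @bounded_has_mean R (nu b) (nu01 b) (fun y => expR (t * (y - mu))) (expR (1/2)).
- apply: measurableT_comp; first exact: measurable_expR.
  by apply: measurable_funM => //; apply: measurable_funB.
- move=> x x01; rewrite ger0_norm ?expR_ge0// ler_expR.
  move: x01 => /andP[y0 y1].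
  apply: le_trans (ler_norm _) _; rewrite normrM.
  have a1 : `|t| <= 1/2 by rewrite ler_norml t0.
  have a2 : `|x - mu| <= 1 by rewrite ler_norml; apply/andP; split; lra.
  by rewrite -[leRHS]mulr1; apply: ler_pM.
exists rho => //.
apply: le_trans (has_mean_le (nu b) _ _ _ _ quad hr (has_mean_affine b _ _)) _.
rewrite -/mu; apply: le_trans (expR_ge1Dx _).
by rewrite le_eqVlt; apply/orP; left; apply/eqP; ring.
Qed.

Lemma sum_pow_le (rho kappa : R) n : 0 <= rho -> rho <= expR (- kappa) -> 0 < kappa ->
  \sum_(0 <= k < n) rho ^+ k <= 1 + kappa^-1.
Proof.
move=> r0 rk k0.
have i0 : 0 <= kappa^-1 by rewrite invr_ge0 ltW.
case: n => [|n]; first by rewrite big_geq// addr_ge0.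
rewrite big_ltn// expr0 lerD2l.
apply: (@le_trans _ _ (\sum_(1 <= k < n.+1) expR (- (k%:R * kappa)))).
  by apply: ler_sum => k _; rewrite -mulrN expRM_natl lerXn2r ?nnegrE ?expR_ge0.
apply: le_trans (sum_expR_geometric _ _ k0) _.
rewrite lef_pV2 ?posrE ?subr_gt0 ?expR_gt1//.
by have := expR_ge1Dx kappa; lra.
Qed.

(** Chernoff's method, one product per pull count k < T: the product of the exponential factors is
    at least 1 on the deviation event and has mean at most e^(-kappa k), a geometric series. *)
Lemma deviation_budget b (sg eps : R) T : `|sg| = 1 -> 0 < eps ->
  let mu := mean nu b in
  exists B c, [/\ budget nu b B c,
    forall l, unit_seq l -> (size l < T)%N ->
      (size l)%:R * eps <= sg * (\sum_(y <- l) y - (size l)%:R * mu) -> 1 <= c l &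
    B [::] <= 1 + 8 * (mu * (1 - mu) + eps) / eps ^+ 2].
Proof.
move=> sg1 e0 mu; set v := mu * (1 - mu).
have /andP[mu0 mu1] : 0 <= mu <= 1 by exact: mean_itv.
have v0 : 0 <= v by rewrite mulr_ge0// subr_ge0.
have ve : 0 < v + eps by rewrite ltr_wpDl.
(* The same near-optimal tilt as in [kl_ge_bernstein]. *)
pose t := eps / (4 * (v + eps)).
have t0 : 0 < t by rewrite divr_gt0// mulr_gt0.
have t1 : t <= 1/4 by rewrite ler_pdivrMr ?mulr_gt0//; clear - v0; lra.
have sg2 : sg ^+ 2 = 1 by rewrite -real_normK ?num_real// sg1 expr1n.
have [|rho0 hr0 rle0] := @has_mean_expR b (sg * t).
  rewrite -ler_norml normrM sg1 mul1r gtr0_norm//; clear - t1; lra.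
pose f y := expR (- (t * eps)) * expR (sg * t * (y - mu)).
pose rho := expR (- (t * eps)) * rho0.
have hr : has_mean (nu b) f rho by exact: has_meanZ.
have f0 y : 0 <= y <= 1 -> 0 <= f y by move=> _; rewrite mulr_ge0 ?expR_ge0.
have r0 : 0 <= rho.
  exact: (has_mean_le (nu b) _ _ _ _ f0 (has_mean_cst _ (nu01 b) 0) hr).
pose kappa := eps ^+ 2 / (8 * (v + eps)).
have k0 : 0 < kappa by rewrite divr_gt0 ?exprn_gt0// mulr_gt0.
have rk : rho <= expR (- kappa).
  apply: le_trans (ler_wpM2l (expR_ge0 _) rle0) _.
  rewrite -exp.expRD ler_expR exprMn sg2 mul1r -/mu -/v.
  have -> : - (t * eps) + 2 * t ^+ 2 * v = - kappa - eps ^+ 3 / (8 * (v + eps) ^+ 2).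
    by rewrite /t /kappa; field; rewrite gt_eqF.
  by rewrite gerBl divr_ge0 ?exprn_ge0 ?mulr_ge0 ?exprn_ge0 ?ltW.
exists (fun l => \sum_(0 <= k < T) oneshot f rho k l).
exists (fun l => \sum_(0 <= k < T) oneshot_cost f k l); split.
- by apply: budget_sum => // k _; exact: oneshot_budget.
- move=> l l01 lT hl.
  rewrite (bigD1_seq (size l)) ?mem_index_iota ?iota_uniq//=.
  rewrite {1}/oneshot_cost eqxx -[leLHS]addr0; apply: lerD; last first.
    apply: sumr_ge0 => k _; rewrite /oneshot_cost; case: ifP => // _.
    by rewrite prodr_ge0// => y _; rewrite mulr_ge0 ?expR_ge0.
  rewrite /f; under eq_bigr do rewrite -exp.expRD.
  rewrite -expR_sum -[leLHS](@exp.expR0 R) ler_expR.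
  rewrite big_split /= -mulr_sumr sumrB !big_const_seq !count_predT !iter_addr_0.
  rewrite -[(- (t * eps)) *+ _]mulr_natl -[mu *+ _]mulr_natl.
  have -> : (size l)%:R * - (t * eps) + sg * t * (\sum_(i <- l) i - (size l)%:R * mu) =
    t * (sg * (\sum_(i <- l) i - (size l)%:R * mu) - (size l)%:R * eps) by ring.
  by rewrite mulr_ge0 ?subr_ge0// ltW.
- apply: (@le_trans _ _ (\sum_(0 <= k < T) rho ^+ k)).
    by apply: ler_sum => k _; rewrite /oneshot /= big_nil mul1r subn0.
  apply: le_trans (sum_pow_le _ _ _ r0 rk k0) _.
  by rewrite /kappa invf_div.
Qed.

Lemma has_mean_bet b (q m : R) : 0 < m < 1 ->
  has_mean (nu b) (bet q m) (1 - (m - q) * (mean nu b - m) / (m * (1 - m))).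
Proof.
move=> /andP[m0 m1].
have -> : bet q m = fun y => (1 - q) / (1 - m) + (q / m - (1 - q) / (1 - m)) * y.
  by apply/funext => y; rewrite /bet; ring.
have -> : 1 - (m - q) * (mean nu b - m) / (m * (1 - m)) =
  (1 - q) / (1 - m) + (q / m - (1 - q) / (1 - m)) * mean nu b.
  by field; rewrite !gt_eqF ?subr_gt0.
exact: has_mean_affine.
Qed.

Lemma sqrt_var_le (m : R) : 0 < m < 1 ->
  [/\ 0 < Num.sqrt (m * (1 - m)), Num.sqrt (m * (1 - m)) <= Num.sqrt m &
   Num.sqrt (m * (1 - m)) <= Num.sqrt (1 - m)].
Proof.
move=> /andP[m0 m1].
have m1' : 0 < 1 - m by rewrite subr_gt0.
split; first by rewrite sqrtr_gt0 mulr_gt0.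
  by rewrite ler_wsqrtr// ler_piMr// ?(ltW m0)// gerBl ltW.
by rewrite ler_wsqrtr// ler_piMl// ltW.
Qed.

(** A difference of squares in either coordinate; the standard deviation sqrt (m (1 - m)) is below
    both sqrt m and sqrt (1 - m), which gives one scale for both grids. *)
Lemma grid_gap (m : R) k i d : 0 < m < 1 -> (0 < k)%N -> grid_ok m k i d ->
  0 < grid_point m k i d /\
  i%:R * step k * Num.sqrt (m * (1 - m)) <= m - grid_point m k i d.
Proof.
move=> m01 k0; have [v0 v1 v2] := sqrt_var_le m m01; move: m01 => /andP[m0 m1].
have ir0 : 0 <= i%:R * step k :> R by rewrite mulr_ge0// ltW// step_gt0.
rewrite /grid_ok /grid_point /grid_sqrt /grid_sqrtC; set w := i%:R * step k in ir0 *.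
have sm : Num.sqrt m ^+ 2 = m by rewrite sqr_sqrtr// ltW.
have sm1 : Num.sqrt (1 - m) ^+ 2 = 1 - m by rewrite sqr_sqrtr// subr_ge0 ltW.
have h1 := ler_wpM2l ir0 v1; have h2 := ler_wpM2l ir0 v2.
case: d => [g0|g1].
- split; first by rewrite exprn_gt0.
  have : 0 <= w * (Num.sqrt m - w) by rewrite mulr_ge0// ltW.
  have -> : m - (Num.sqrt m - w) ^+ 2 = w * Num.sqrt m + w * (Num.sqrt m - w).
    by rewrite -{1}sm; ring.
  by move=> ?; rewrite (le_trans h1)// lerDl.
- split.
    by rewrite subr_gt0 expr_lt1// addr_ge0// sqrtr_ge0.
  have -> : m - (1 - (Num.sqrt (1 - m) + w) ^+ 2) =
      w * Num.sqrt (1 - m) + (w * Num.sqrt (1 - m) + w ^+ 2).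
    move: sm1; move: (Num.sqrt (1 - m)) => S sm1.
    have -> : m = 1 - S ^+ 2 by rewrite sm1; ring.
    by ring.
  by rewrite (le_trans h2)// lerDl addr_ge0 ?sqr_ge0// mulr_ge0// sqrtr_ge0.
Qed.

End ArmBudgets.

(** * Cost of underestimating the best arm *)

Lemma ler_sum_term {R : realType} (I : eqType) (r : seq I) (p : pred I) (F : I -> R) j :
  j \in r -> p j -> (forall i, p i -> 0 <= F i) -> F j <= \sum_(i <- r | p i) F i.
Proof. by move=> jr pj F0; rewrite (big_rem j)//= pj lerDl sumr_ge0. Qed.

Section Underestimation.
Context {R : realType} {K : nat}.
Variable nu : 'I_K -> probability (measurableTypeR R) R.
Hypothesis nu01 : forall a, nu a [set x : R | 0 <= x <= 1]%classic = 1%E.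

(** From 1 - x <= e^(-x), with m - q linear in i by [grid_gap]; since k (step k) = sqrt k / 16, the
    k-th power decays in i sqrt k. *)
Lemma grid_pow_le b (m : R) k i d : 0 < m < 1 -> m <= mean nu b -> (0 < k)%N ->
  grid_ok m k i d ->
  let q := grid_point m k i d in
  let rho := 1 - (m - q) * (mean nu b - m) / (m * (1 - m)) in
  budget nu b (oneshot (bet q m) rho k) (oneshot_cost (bet q m) k) /\
  rho ^+ k <= expR (- (i%:R * ((mean nu b - m) / (16 * Num.sqrt (m * (1 - m))) * Num.sqrt k%:R))).
Proof.
move=> m01 me k0 ok q rho.
have [q0 gap] := grid_gap m k i d m01 k0 ok; rewrite -/q in q0 gap.
have [sd0 _ _] := sqrt_var_le m m01.
have r0 : 0 < step k :> R by exact: step_gt0.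
have q1 : q < 1.
  have : 0 <= i%:R * step k * Num.sqrt (m * (1 - m)).
    exact: mulr_ge0 (mulr_ge0 (ler0n _ i) (ltW r0)) (ltW sd0).
  move: m01 gap => /andP[m0 m1]; move: (i%:R * _ * _) => w; clear - m1; lra.
have q01 : 0 < q < 1 by rewrite q0.
have f0 y : 0 <= y <= 1 -> 0 <= bet q m y by move=> y01; rewrite ltW// bet_gt0.
have hr : has_mean (nu b) (bet q m) rho by exact: has_mean_bet.
split; first exact: oneshot_budget.
have rho0 : 0 <= rho.
  exact: (has_mean_le (nu b) _ _ _ _ f0 (has_mean_cst _ (nu01 b) 0) hr).
set sd := Num.sqrt _ in sd0 gap *.
have sdE : m * (1 - m) = sd ^+ 2.
  by move/andP: m01 => [m0 m1]; rewrite sqr_sqrtr// mulr_ge0// ?subr_ge0 ltW.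
set e := mean nu b - m.
have e0 : 0 <= e by rewrite subr_ge0.
apply: (@le_trans _ _ (expR (- ((m - q) * e / sd ^+ 2)) ^+ k)).
  rewrite lerXn2r ?nnegrE ?expR_ge0//.
  by apply: le_trans (expR_ge1Dx _); rewrite /rho -/e sdE.
rewrite -expRM_natl ler_expR mulrN lerN2.
have kr : k%:R * step k = Num.sqrt k%:R / 16 :> R.
  have sk : 0 < Num.sqrt k%:R :> R by rewrite sqrtr_gt0 ltr0n.
  by rewrite /step -{1}[k%:R](@sqr_sqrtr R) ?ler0n//; field; rewrite gt_eqF.
have -> : i%:R * (e / (16 * sd) * Num.sqrt k%:R) =
    k%:R * (i%:R * step k * sd * (e / sd ^+ 2)).
  have -> : k%:R * (i%:R * step k * sd * (e / sd ^+ 2)) =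
    k%:R * step k * (i%:R * sd * (e / sd ^+ 2)) by ring.
  by rewrite kr; field; rewrite gt_eqF.
by rewrite ler_wpM2l// -[leRHS]mulrA ler_wpM2r// divr_ge0// sqr_ge0.
Qed.

(** The maximum of the likelihood ratios over the grid is replaced by their sum, each ratio being
    paid by its own one-shot budget. *)
Lemma underestimation_budget b (m : R) T : 0 < m < 1 -> m < mean nu b ->
  let e := mean nu b - m in
  exists B c, [/\ budget nu b B c,
    forall l x, unit_seq l -> (size l < T)%N -> (size l)%:R * x = \sum_(y <- l) y ->
      0 <= x <= m -> expR ((size l)%:R * kl x m) <= c l &
    B [::] <= expR 1 * (1 + 8 * (mean nu b * (1 - mean nu b) + e) / e ^+ 2 +
                       27 * 32 * 32 * (m * (1 - m)) / e ^+ 2)].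
Proof.
move=> m01 mb e.
have e0 : 0 < e by rewrite subr_gt0.
have [|B0 [c0 [bud0 c0P B0P]]] := @deviation_budget R K nu nu01 b (-1) e T _ e0.
  by rewrite normrN1.
pose q k i d := grid_point m k i d.
pose rho k i d := 1 - (m - q k i d) * (mean nu b - m) / (m * (1 - m)).
(* The filter on [k] hands its positivity to [budget_sum]. *)
pose Bg l := \sum_(1 <= k < T | (0 < k)%N) \sum_(1 <= i < (16 * k).+1)
  \sum_(d : bool | grid_ok m k i d) oneshot (bet (q k i d) m) (rho k i d) k l.
pose cg l := \sum_(1 <= k < T | (0 < k)%N) \sum_(1 <= i < (16 * k).+1)
  \sum_(d : bool | grid_ok m k i d) oneshot_cost (bet (q k i d) m) k l.
have budd k i d : (0 < k)%N -> grid_ok m k i d ->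
    budget nu b (oneshot (bet (q k i d) m) (rho k i d) k) (oneshot_cost (bet (q k i d) m) k).
  by move=> k0 ok; have [] := grid_pow_le b m k i d m01 (ltW mb) k0 ok.
have budi k i : (0 < k)%N -> budget nu b
    (fun l => \sum_(d : bool | grid_ok m k i d) oneshot (bet (q k i d) m) (rho k i d) k l)
    (fun l => \sum_(d : bool | grid_ok m k i d) oneshot_cost (bet (q k i d) m) k l).
  by move=> k0; apply: budget_sum => // d; exact: budd.
have budk k : (0 < k)%N -> budget nu b
    (fun l => \sum_(1 <= i < (16 * k).+1)
       \sum_(d : bool | grid_ok m k i d) oneshot (bet (q k i d) m) (rho k i d) k l)
    (fun l => \sum_(1 <= i < (16 * k).+1)
       \sum_(d : bool | grid_ok m k i d) oneshot_cost (bet (q k i d) m) k l).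
  by move=> k0; apply: budget_sum => // i _; exact: budi.
have budg : budget nu b Bg cg by apply: budget_sum.
exists (fun l => expR 1 * (B0 l + Bg l)), (fun l => expR 1 * (c0 l + cg l)); split.
- by apply: budgetZ; [exact: expR_ge0|exact: budgetD].
- move=> l x l01 lT lx /andP[x0 xm].
  have c01 : 1 <= c0 l.
    apply: c0P => //; rewrite -lx mulN1r /e.
    rewrite -mulrBr -mulrN ler_wpM2l//; move: xm; clear; lra.
  have cg0 : 0 <= cg l by have [_ [h _]] := budg; exact: h.
  (* Used for no rewards and for the reference point [m]: the exponential is then at most e, and x
     <= m is itself a deviation by [e], paid by [c0]. *)
  have trivial_bound : expR ((size l)%:R * kl x m) <= expR 1 ->
      expR ((size l)%:R * kl x m) <= expR 1 * (c0 l + cg l).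
    move=> /le_trans; apply; rewrite ler_peMr ?expR_ge0//.
    by rewrite (le_trans c01)// lerDl.
  have [k0|k0] := posnP (size l).
    by apply: trivial_bound; rewrite k0 mul0r ler_expR.
  have x0m : 0 <= x <= m by rewrite x0.
  have [q' [q01 klq [qm|[i [d [/andP[i0 ik] ok qE]]]]]] := grid_approx m x (size l) m01 x0m k0.
    by apply: trivial_bound; rewrite ler_expR -qm.
  have x01 : 0 <= x <= 1.
    by rewrite x0 (le_trans xm)//; have /andP[_ /ltW] := m01.
  apply: le_trans (expR_kl_le_bet _ _ _ _ l01 lx x01 q01 m01) _.
  have P0 : 0 <= \prod_(y <- l) bet q' m y.
    by rewrite big_seq prodr_ge0// => y /(allP l01) y01; rewrite ltW// bet_gt0.
  apply: (@le_trans _ _ (expR 1 * \prod_(y <- l) bet q' m y)).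
    by rewrite ler_wpM2r// ler_expR.
  rewrite ler_wpM2l ?expR_ge0//.
  apply: (@le_trans _ _ (cg l)); last by rewrite lerDr (le_trans ler01).
  have -> : \prod_(y <- l) bet q' m y = oneshot_cost (bet (q (size l) i d) m) (size l) l.
    by rewrite /oneshot_cost eqxx qE.
  apply: (@le_trans _ _ (\sum_(d : bool | grid_ok m (size l) i d)
      oneshot_cost (bet (q (size l) i d) m) (size l) l)).
    apply: (@ler_sum_term _ _ _ _
      (fun d => oneshot_cost (bet (q (size l) i d) m) (size l) l)) => //.
      by rewrite mem_index_enum.
    by move=> d' ok'; have [_ [h _]] := budd _ _ _ k0 ok'; exact: h.
  apply: (@le_trans _ _ (\sum_(1 <= i < (16 * size l).+1)
      \sum_(d : bool | grid_ok m (size l) i d)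
      oneshot_cost (bet (q (size l) i d) m) (size l) l)).
    apply: (@ler_sum_term _ _ _ _ (fun i => \sum_(d : bool | grid_ok m (size l) i d)
      oneshot_cost (bet (q (size l) i d) m) (size l) l)) => //.
      by rewrite mem_index_iota i0.
    by move=> i' _; have [_ [h _]] := budi (size l) i' k0; exact: h.
  apply: (@ler_sum_term _ _ _ _ (fun k => \sum_(1 <= i < (16 * k).+1)
      \sum_(d : bool | grid_ok m k i d) oneshot_cost (bet (q k i d) m) k l)) => //.
    by rewrite mem_index_iota k0.
  by move=> k' k0'; have [_ [h _]] := budk _ k0'; exact: h.
- rewrite ler_wpM2l ?expR_ge0// lerD//.
  have [sd0 _ _] := sqrt_var_le m m01.
  set sd := Num.sqrt _ in sd0.
  have sdE : m * (1 - m) = sd ^+ 2.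
    by move/andP: m01 => [m0 m1]; rewrite sqr_sqrtr// mulr_ge0// ?subr_ge0 ltW.
  pose be := e / (16 * sd).
  have be0 : 0 < be by rewrite divr_gt0// mulr_gt0.
  (* The factor 2 counts the two grids, and 54 comes from [sum_inv_expR_sqrt]. *)
  have -> : 27 * 32 * 32 * (m * (1 - m)) / e ^+ 2 = 2 * (54 / be ^+ 2).
    by rewrite sdE /be; field; rewrite !gt_eqF.
  apply: le_trans (ler_wpM2l _ (sum_inv_expR_sqrt be T be0)) => //.
  rewrite mulr_sumr /Bg big_mkcond /=.
  apply: ler_sum_nat => k /andP[k0 _]; rewrite k0.
  have y0 : 0 < be * Num.sqrt k%:R by rewrite mulr_gt0// sqrtr_gt0 ltr0n.
  apply: le_trans (ler_wpM2l _ (sum_expR_geometric _ (16 * k).+1 y0)) => //.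
  rewrite mulr_sumr; apply: ler_sum => i _.
  have E0 : 0 <= expR (- (i%:R * (be * Num.sqrt k%:R))) by exact: expR_ge0.
  rewrite big_mkcond big_bool /= mulr2n mulrDl !mul1r; apply: lerD; case: ifP => // ok;
    rewrite /oneshot /= big_nil mul1r subn0.
  + by have [_] := grid_pow_le b m k i true m01 (ltW mb) k0 ok.
  + by have [_] := grid_pow_le b m k i false m01 (ltW mb) k0 ok.
Qed.

End Underestimation.

(** * Expected number of pulls of a suboptimal arm *)

Section ArmPulls.
Context {R : realType} {K : nat}.
Implicit Types (h : history (R := R) K).
Variable nu : 'I_K -> probability (measurableTypeR R) R.
Hypothesis nu01 : forall a, nu a [set x : R | 0 <= x <= 1]%classic = 1%E.
Hypothesis K0 : (0 < K)%N.

Lemma kl_separation (mu1 mua p q : R) : 0 <= mu1 <= 1 -> mua < mu1 ->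
  0 <= p -> p <= mua + (mu1 - mua) / 4 -> mu1 - (mu1 - mua) / 4 <= q -> q <= 1 ->
  ~~ kl_infinite p q ->
  (mu1 - mua) ^+ 2 / (32 * (mu1 * (1 - mu1) + (mu1 - mua))) <= kl p q.
Proof.
move=> /andP[m0 m1] d0 p0 pa qm q1 fin.
set d := mu1 - mua in pa qm *; have {}d0 : 0 < d by rewrite subr_gt0.
have dE : mua = mu1 - d by rewrite subKr.
rewrite dE in pa; clearbody d; clear dE mua.
have pq : p <= q by lra.
apply: le_trans (kl_ge_bernstein _ _ p0 pq q1 fin).
pose z := q - p; have dz : d <= 2 * z by rewrite /z; lra.
set w := q * (1 - q); set s := mu1 * (1 - mu1).
have w0 : 0 <= w by rewrite mulr_ge0 ?subr_ge0// (le_trans p0).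
have s0 : 0 <= s by rewrite mulr_ge0 ?subr_ge0.
have z0 : 0 < z by lra.
(* The variance x (1 - x) is 1-Lipschitz, and q is within z of mu1. *)
have wsz : w <= s + z.
  have q0 : 0 <= q by exact: le_trans pq.
  have [a1 a2] : mu1 - q <= z /\ q - mu1 <= z by rewrite /z; split; lra.
  rewrite /w /s; clear - a1 a2 q0 q1 m0 m1 z0.
  have [h|h] := leP q mu1.
    have : (mu1 - q) * (1 - mu1) <= z * 1 by apply: ler_pM; lra.
    have : 0 <= (mu1 - q) * q by apply: mulr_ge0; lra.
    nra.
  have : (q - mu1) * (1 - q) <= z * 1 by apply: ler_pM; lra.
  have : 0 <= (q - mu1) * mu1 by apply: mulr_ge0; lra.
  nra.
have sd : 0 < s + d by rewrite ltr_wpDl.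
have wz : 0 < w + z by rewrite ltr_wpDl.
rewrite -/z ler_pdivrMr ?mulr_gt0// mulrAC ler_pdivlMr ?mulr_gt0//.
have d2 : d ^+ 2 <= 4 * z ^+ 2.
  have -> : 4 * z ^+ 2 = (2 * z) ^+ 2 by ring.
  by rewrite ler_sqr ?nnegrE ?(ltW d0)// mulr_ge0// ltW.
apply: (@le_trans _ _ (d ^+ 2 * (8 * (s + 2 * z)))).
  by rewrite ler_wpM2l ?sqr_ge0//; clear - wsz; lra.
have h1 : d ^+ 2 * s <= 4 * z ^+ 2 * s by rewrite ler_wpM2r.
have h2 : d * (d * z) <= (2 * z) * (d * z) by rewrite ler_wpM2r// mulr_ge0// ltW.
clear - h1 h2; rewrite !expr2 in h1 *; nra.
Qed.

(** The four summands match the four ways of paying for a pull: few pulls so far, [emp_max] at least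
    mu1 - d/4, arm [a] overestimated, and [emp_max] below mu1 - d/4. *)
Lemma klms_policy_le (T u : nat) (q : R) (i0 a : 'I_K) (ca c0 : seq R -> R) h :
  let mu1 := mean nu i0 in let mua := mean nu a in let d := mu1 - mua in
  0 < d ->
  (forall l, unit_seq l -> 0 <= ca l) -> (forall l, unit_seq l -> 0 <= c0 l) ->
  (forall l, unit_seq l -> (size l < T)%N ->
    (size l)%:R * (d / 4) <= 1 * (\sum_(y <- l) y - (size l)%:R * mua) -> 1 <= ca l) ->
  (forall l x, unit_seq l -> (size l < T)%N -> (size l)%:R * x = \sum_(y <- l) y ->
    0 <= x <= mu1 - d / 4 -> expR ((size l)%:R * kl x (mu1 - d / 4)) <= c0 l) ->
  expR (- (u%:R * (d ^+ 2 / (32 * (mu1 * (1 - mu1) + d))))) <= q ->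
  unit_history h -> (K <= size h < T)%N ->
  klms_policy h a <= klms_policy h a * (pulls h a < u)%:R + q +
      klms_policy h a * ca (rewards h a) + klms_policy h i0 * c0 (rewards h i0).
Proof.
move=> mu1 mua d d0 ca0 c00 caP c0P uq hh /andP[Kh hT].
have ra := unit_rewards h a hh; have r0 := unit_rewards h i0 hh.
have pa := klms_policy_ge0 h a K0 hh; have p0 := klms_policy_ge0 h i0 K0 hh.
have q0 : 0 <= q by apply: le_trans uq; exact: expR_ge0.
have sa b : (size (rewards h b) < T)%N.
  by rewrite size_rewards (leq_ltn_trans (pulls_le _ _)).
have t2 := mulr_ge0 pa (ca0 _ ra); have t3 := mulr_ge0 p0 (c00 _ r0).
have [Na|Na] := ltnP (pulls h a) u.
  suff H (p x y : R) : 0 <= x -> 0 <= y -> p <= p * true%:R + q + x + y by exact: H.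
  by move=> x0 y0; rewrite mulr1 -!addrA lerDl !addr_ge0.
suff : klms_policy h a <= q + klms_policy h a * ca (rewards h a) +
    klms_policy h i0 * c0 (rewards h i0).
  suff H (p x y : R) : p <= q + x + y -> p <= p * false%:R + q + x + y by exact: H.
  by rewrite mulr0 add0r.
have /andP[ea0 ea1] := emp_mean_itv h a hh.
have [he|he] := leP (mua + d / 4) (emp_mean h a).
  have c1 : 1 <= ca (rewards h a).
    apply: caP => //; rewrite -emp_mean_sum mul1r -mulrBr ler_wpM2l//.
    by rewrite lerBrDl.
  rewrite -[leLHS]mulr1 (le_trans (ler_wpM2l pa c1))//.
  by rewrite -addrA addrCA lerDl addr_ge0.
have W1 := klms_weight_sum_ge1 h K0 hh.
have W0 : 0 < \sum_b klms_weight h b by apply: lt_le_trans W1.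
have /andP[wa0 wa1] := klms_weight_itv h a K0 hh.
have piE b : klms_policy h b = klms_weight h b / \sum_b klms_weight h b.
  by rewrite /klms_policy ltnNge Kh.
have [b eb] := emp_max_attained h K0 hh.
have /andP[em0 em1] : 0 <= emp_max h <= 1 by rewrite eb; exact: emp_mean_itv.
have /andP[mu10 mu11] : 0 <= mu1 <= 1 by exact: mean_itv.
(* Above the threshold, the weights sum to at least 1, so the probability is at most the weight,
   which [kl_separation] bounds after [u] pulls. *)
have [hm|hm] := leP (mu1 - d / 4) (emp_max h).
  suff wq : klms_weight h a <= q.
    apply: (@le_trans _ _ q); last by rewrite -addrA lerDl addr_ge0.
    rewrite piE ler_pdivrMr// (le_trans wq)// -[leLHS]mulr1 ler_wpM2l//.
  rewrite /klms_weight /kl_weight; case: ifPn => // fin.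
  apply: le_trans uq; rewrite ler_expR lerN2.
  apply: ler_pM => //.
  - by rewrite divr_ge0 ?sqr_ge0// mulr_ge0// addr_ge0 ?(ltW d0)// mulr_ge0// subr_ge0.
  - by rewrite ler_nat.
  - apply: kl_separation => //; [exact/andP|by rewrite -subr_gt0|exact: ltW].
(* Below it, the probabilities of [a] and [i0] compare as their weights: that of [a] is at most 1,
   and the inverse of that of [i0] grows when [emp_max] is raised to the threshold. *)
apply: (@le_trans _ _ (klms_policy h i0 * c0 (rewards h i0))); last first.
  by rewrite lerDr addr_ge0.
rewrite !piE mulrAC ler_pM2r ?invr_gt0// (le_trans wa1)//.
have /andP[x0 x1] := emp_mean_itv h i0 hh; have xm := emp_mean_le_max h i0.
have mm1 : mu1 - d / 4 < 1 by clear - d0 mu11; lra.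
have mm0 : 0 < mu1 - d / 4 by apply: le_lt_trans hm.
have fin : ~~ kl_infinite (emp_mean h i0) (emp_max h).
  rewrite /kl_infinite negb_or !negb_and !negbK.
  rewrite [emp_max h == 1]lt_eqF ?(lt_trans hm)//= andbT.
  by have [e0|//] := eqVneq (emp_max h) 0; rewrite orFb eq_le x0 -e0 xm.
have := c0P _ (emp_mean h i0) r0 (sa i0) (emp_mean_sum h i0).
rewrite x0 (le_trans xm (ltW hm)) => /(_ isT) hc.
rewrite /klms_weight /kl_weight (negPf fin) exp.expRN -size_rewards.
rewrite -(ler_pM2l (expR_gt0 ((size (rewards h i0))%:R * kl (emp_mean h i0) (emp_max h)))).
rewrite mulr1 mulrA mulfV ?gt_eqF ?expR_gt0// mul1r.
apply: le_trans hc; rewrite ler_expR ler_wpM2l//.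
by apply: kl_mono => //; [exact: ltW|rewrite mm0].
Qed.

Lemma arm_pulls_potential (T : nat) (i0 a : 'I_K) :
  let mu1 := mean nu i0 in let d := mu1 - mean nu a in
  let s := mu1 * (1 - mu1) in
  let M := (s + d) / d ^+ 2 in
  (0 < T)%N -> 0 < d ->
  exists F, potential nu T (fun b => (b == a)%:R) F /\
    F T [::] <= (200 + 30 * 30 * 32 * 32 * expR 1) * (M * (1 + ln (Num.max 1 (T%:R / M)))).
Proof.
move=> mu1 d s M T0 d0.
have /andP[mu10 mu11] : 0 <= mu1 <= 1 by exact: mean_itv.
have /andP[mua0 mua1] : 0 <= mean nu a <= 1 by exact: mean_itv.
have dE : mean nu a = mu1 - d by rewrite subKr.
have d1 : d <= mu1 by rewrite gerBl.
have s0 : 0 <= s by rewrite mulr_ge0// subr_ge0.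
have sd0 : 0 < s + d by rewrite ltr_wpDl.
have ME : M = (s + d) / d ^+ 2 by [].
clearbody M.
have M0 : 0 < M by rewrite ME divr_gt0// exprn_gt0.
have M1 : 1 <= M.
  rewrite ME ler_pdivlMr ?exprn_gt0// mul1r.
  have : d ^+ 2 <= d by rewrite expr2 ler_piMr ?(ltW d0)// (le_trans d1).
  by move=> /le_trans; apply; rewrite lerDr.
set L := ln _.
have L0 : 0 <= L by rewrite ln_ge0// le_max lexx.
(* The successor makes u / (32 M) exceed L, so that e^(-u / (32 M)) <= M / T; then T rounds at [q]
   cost M in total. *)
pose u := (Num.truncn (32 * M * L)).+1.
have ML0 : 0 <= 32 * M * L by rewrite mulr_ge0// mulr_ge0// ltW.
have /andP[ul uu] := truncn_itv ML0.
pose q := M / T%:R.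
have T0' : (0 : R) < T%:R by rewrite ltr0n.
have q0 : 0 <= q by rewrite divr_ge0// ltW.
have dM : d ^+ 2 / (32 * (s + d)) = (32 * M)^-1.
  by rewrite ME; field; rewrite !gt_eqF.
have uq : expR (- (u%:R * (d ^+ 2 / (32 * (s + d))))) <= q.
  apply: (@le_trans _ _ (expR (- L))).
    have M32 : 0 < 32 * M by apply: mulr_gt0.
    rewrite ler_expR lerN2 dM (ler_pdivlMr _ _ M32).
    by rewrite mulrC (le_trans (ltW uu)).
  rewrite exp.expRN lnK ?posrE ?lt_max ?ltr01// /q -[M / _]invf_div lef_pV2 ?posrE ?lt_max ?ltr01 ?divr_gt0//.
  by rewrite le_max lexx orbT.
have e0 : 0 < d / 4 by rewrite divr_gt0.
have [|B3 [c3 [bud3 c3P B3P]]] := @deviation_budget R K nu nu01 a 1 (d / 4) T _ e0.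
  by rewrite normr1.
pose m := mu1 - d / 4.
have m01 : 0 < m < 1 by rewrite /m; clear - d0 d1 mu11; apply/andP; split; lra.
have mb : m < mean nu i0 by rewrite gtrBl.
have em : mean nu i0 - m = d / 4 by rewrite /m -/mu1; ring.
have [B4 [c4 [bud4 c4P B4P]]] := @underestimation_budget R K nu nu01 i0 m T m01 mb.
rewrite em -/mu1 -/s in B4P.
exists (arm_potential a i0 u q B3 B4); split.
  have [_ [c30 _]] := bud3; have [_ [c40 _]] := bud4.
  apply: (arm_potentialP nu nu01 K0 T a i0 u q B3 B4 c3 c4) => // h hh hK.
  exact: (klms_policy_le T u q i0 a c3 c4 h).
rewrite /arm_potential /= /rewards /= ?leq0n subn0.
have Tq : T%:R * q = M by rewrite /q mulrC divfK// gt_eqF.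
rewrite Tq.
have uM : u%:R <= 32 * M * L + 1 :> R by rewrite /u -natr1 lerD2r.
have d2 : 0 < d ^+ 2 by rewrite exprn_gt0.
have B3M : B3 [::] <= 1 + 160 * M.
  apply: le_trans B3P _; rewrite lerD2l dE.
  have -> : 8 * ((mu1 - d) * (1 - (mu1 - d)) + d / 4) / (d / 4) ^+ 2 =
     8 * 16 * ((mu1 - d) * (1 - (mu1 - d)) + d / 4) / d ^+ 2 by field; rewrite gt_eqF.
  have -> : 160 * M = 160 * (s + d) / d ^+ 2 by rewrite ME mulrA.
  rewrite ler_pM2r ?invr_gt0//.
  (* The variance proxy of arm [a] exceeds that of the best arm by at most its gap. *)
  have : (mu1 - d) * (1 - (mu1 - d)) <= s + d.
    have mu1' : 0 <= 1 - mu1 by rewrite subr_ge0.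
    have md : 0 <= mu1 - d by rewrite subr_ge0.
    have := mulr_ge0 md mu1'; have := mulr_ge0 (ltW d0) mu1'.
    have : d * (mu1 - d) <= d * 1 by rewrite (ler_wpM2l (ltW d0))//; clear - mu11 d0; lra.
    by rewrite /s; move: (d); clear; move=> d'; nra.
  clear - d0 s0; lra.
have e1 : 1 <= expR 1 :> R by rewrite -exp.expR0 ler_expR.
have B4M : B4 [::] <= expR 1 * ((161 + 30 * 30 * 16 * 31) * M).
  apply: le_trans B4P _; rewrite ler_wpM2l ?expR_ge0//.
  have -> : 8 * (s + d / 4) / (d / 4) ^+ 2 = 128 * (s + d / 4) / d ^+ 2.
    by field; rewrite gt_eqF.
  have -> : 27 * 32 * 32 * (m * (1 - m)) / (d / 4) ^+ 2 =
     27 * 32 * 16 * 32 * (m * (1 - m)) / d ^+ 2 by field; rewrite gt_eqF.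
  have h1 : 128 * (s + d / 4) / d ^+ 2 <= 128 * M.
    by rewrite ME mulrA ler_pM2r ?invr_gt0//; clear - d0; lra.
  have h2 : 27 * 32 * 16 * 32 * (m * (1 - m)) / d ^+ 2 <= 27 * 32 * 16 * 32 * M.
    rewrite ME [leRHS]mulrA ler_pM2r ?invr_gt0// ler_wpM2l// /m /s.
    by clear - d0 d1 mu10 mu11; nra.
  clear - h1 h2 M1; lra.
(* The additive constants are absorbed by M >= 1. *)
apply: (@le_trans _ _ (1 + (32 * M * L + 1) + M + (1 + 160 * M) +
   expR 1 * ((161 + 30 * 30 * 16 * 31) * M))).
  by rewrite !lerD.
have ML : 0 <= M * L by rewrite mulr_ge0// ltW.
have eML : 0 <= expR 1 * (M * L) by rewrite mulr_ge0 ?expR_ge0.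
have eM : 0 <= expR 1 * M by rewrite mulr_ge0 ?expR_ge0// ltW.
move: (expR 1) e1 eML eM => E e1 eML eM; clear - ML eML eM M1.
nra.
Qed.

End ArmPulls.

(** * Regret *)

Section Regret.
Context {R : realType}.

Lemma ln2_ge : 1/2 <= ln 2 :> R.
Proof.
have := @lnB_ge R 2 1; rewrite ln1 subr0 => h.
by have : (1 : R) - 1 / 2 <= ln 2; [exact: h|lra].
Qed.

Lemma ln_le_twice_sqr (w : R) : 0 < w -> ln (w ^+ 2) <= 2 * w.
Proof.
move=> w0; rewrite lnXn// -[_ *+ _]mulr_natl ler_wpM2l//.
by apply: ltW; exact: ln_sublinear.
Qed.

(* [D] is the gap below which arms are charged to the horizon; there
   [D = sqrt (s k (ln k) / T)]. *)
Lemma arm_cost_le (s d k D T M : R) : 0 <= s -> 0 <= D -> D < d -> d <= 1 -> 2 <= k -> 2 <= T ->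
  D ^+ 2 * T = s * k * ln k ->
  M = (s + d) / d ^+ 2 ->
  d * (M * (1 + ln (Num.max 1 (T / M)))) <= 8 * (T * D / k) + 3 * ln T.
Proof.
move=> s0 D0 Dd d1 k2 T2 DE ME.
have d0 : 0 < d by apply: le_lt_trans Dd.
have sd0 : 0 < s + d by rewrite ltr_wpDl.
have d20 : 0 < d ^+ 2 by rewrite exprn_gt0.
have M0 : 0 < M by rewrite ME divr_gt0.
have M1 : 1 <= M.
  rewrite ME ler_pdivlMr// mul1r.
  have : d ^+ 2 <= d by rewrite expr2 ler_piMr ?(ltW d0).
  by move=> /le_trans; apply; rewrite lerDr.
have k0 : 0 < k by apply: lt_le_trans k2.
have T0 : 0 < T by apply: lt_le_trans T2.
have lk : 1/2 <= ln k.
  by apply: le_trans ln2_ge _; rewrite ler_ln ?posrE.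
have lT : 1/2 <= ln T.
  by apply: le_trans ln2_ge _; rewrite ler_ln ?posrE.
have lk0 : 0 < ln k by apply: lt_le_trans lk.
have TM0 : 0 < T / M by rewrite divr_gt0.
set L := ln _.
have mx0 : 0 < Num.max 1 (T / M) by rewrite lt_max ltr01.
have LT : L <= ln T.
  rewrite ler_ln ?posrE// ge_max; apply/andP; split; first by rewrite (le_trans _ T2)// ler1n.
  by rewrite ler_pdivrMr// ler_peMr// ltW.
have -> : d * (M * (1 + L)) = s / d * (1 + L) + (1 + L).
  by rewrite ME; field; rewrite gt_eqF.
apply: lerD; last by clear - lT LT; lra.
(* With s = 0 the threshold [D] is 0 and cannot be divided by, but the variance term vanishes. *)
have [->|sn0] := eqVneq s 0.
  by rewrite !mul0r mulr_ge0// divr_ge0 ?(ltW k0)// mulr_ge0// ltW.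
have {sn0}s0 : 0 < s by rewrite lt_def sn0.
have Dp : 0 < D.
  rewrite lt_def D0 andbT; apply/eqP => Dz; move: DE; rewrite Dz expr0n mul0r => /esym/eqP.
  by rewrite gt_eqF// !mulr_gt0.
pose w := d / D.
have w1 : 1 <= w by rewrite ler_pdivlMr// mul1r ltW.
have w0 : 0 < w by apply: lt_le_trans w1.
have wE : w = d / D by [].
clearbody w.
(* By the choice of [D], T / M <= T d^2 / s = k (ln k) w^2, which trades ln T for ln k; the 2 w is
   compensated by s / d = (s / D) / w. *)
have Lle : L <= 2 * ln k + 2 * w.
  have -> : 2 * ln k = ln k + ln k by ring.
  apply: (@le_trans _ _ (ln (k * ln k * w ^+ 2))).
    have kk1 : 1 <= k * ln k.
      by rewrite -[leLHS](divff (_ : 2 != 0)) ?pnatr_eq0// ler_pM// ?divr_ge0// -div1r.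
    have pos : 0 < k * ln k * w ^+ 2.
      by apply: mulr_gt0; [exact: mulr_gt0|exact: exprn_gt0].
    rewrite ler_ln ?posrE// ge_max; apply/andP; split.
      by rewrite -[leLHS]mulr1 ler_pM// exprn_ege1.
    have -> : k * ln k * w ^+ 2 = T * (d ^+ 2 / s).
      have -> : k * ln k = D ^+ 2 * T / s by rewrite DE; field; rewrite gt_eqF.
      by rewrite wE; field; rewrite !gt_eqF.
    rewrite ler_wpM2l ?(ltW T0)// ME invf_div ler_wpM2l ?(ltW d20)//.
    by rewrite lef_pV2 ?posrE// lerDl ltW.
  rewrite lnM ?posrE ?mulr_gt0 ?exprn_gt0//.
  apply: lerD; last exact: ln_le_twice_sqr w0.
  rewrite lnM ?posrE// lerD2l; apply: ltW; exact: ln_sublinear.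
have -> : T * D / k = s * ln k / D.
  have -> : T = s * k * ln k / D ^+ 2 by rewrite -DE; field; rewrite gt_eqF.
  by field; rewrite !gt_eqF.
have -> : s / d * (1 + L) = s / D * ((1 + L) / w).
  by rewrite wE; field; rewrite !gt_eqF.
have -> : 8 * (s * ln k / D) = s / D * (8 * ln k) by ring.
rewrite ler_wpM2l ?divr_ge0 ?(ltW s0) ?(ltW Dp)// ler_pdivrMr//.
have : ln k * 1 <= ln k * w by rewrite ler_wpM2l ?(ltW lk0).
have : 1/2 * w <= ln k * w by rewrite ler_wpM2r ?(ltW w0).
clear - Lle w1 lk; lra.
Qed.

Context {K : nat}.
Variable nu : 'I_K -> probability (measurableTypeR R) R.
Hypothesis nu01 : forall a, nu a [set x : R | 0 <= x <= 1]%classic = 1%E.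

Lemma klms_regret_le T F : (0 < K)%N ->
  potential nu T (fun b => mu_best nu - mean nu b) F -> (klms_regret nu T <= (F T [::])%:E)%E.
Proof.
move=> K0 pF; have := exp_future_reward_ge nu nu01 K0 T F T [::] pF isT (add0n T).
rewrite /klms_regret; case: (exp_future_reward _ _ _) => [r| |].
- by rewrite -EFinB !lee_fin lerBlDl lerBlDr addrC.
- by rewrite addeNy leNye.
- by rewrite leeNy_eq.
Qed.

Lemma mu_bestE (i0 : 'I_K) : (forall i, mean nu i <= mean nu i0) -> mu_best nu = mean nu i0.
Proof.
move=> h; apply/eqP; rewrite eq_le le_bigmax andbT.
by apply/bigmax_leP; split => // ; have /andP[] := mean_itv nu nu01 i0.
Qed.

Lemma potentialD T c1 c2 F1 F2 : potential nu T c1 F1 -> potential nu T c2 F2 ->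
  potential nu T (fun b => c1 b + c2 b) (fun n h => F1 n h + F2 n h).
Proof.
move=> [p1 q1] [p2 q2]; split=> [h hh|n h hh hT]; first by rewrite addr_ge0 ?p1 ?p2.
have [m1 mE1 le1] := q1 n h hh hT; have [m2 mE2 le2] := q2 n h hh hT.
exists (fun b => m1 b + m2 b); first by move=> b; exact: has_meanD.
apply: le_trans (lerD le1 le2); rewrite -big_split /=.
by rewrite le_eqVlt; apply/orP; left; apply/eqP; apply: eq_bigr => b _; ring.
Qed.

Lemma potential_le T c c' F : (0 < K)%N -> (forall b, c b <= c' b) ->
  potential nu T c' F -> potential nu T c F.
Proof.
move=> K0 cc [p q]; split=> // n h hh hT; have [m mE le] := q n h hh hT.
exists m => //; apply: le_trans le; apply: ler_sum => b _.
by rewrite ler_wpM2l ?klms_policy_ge0// lerD2r.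
Qed.

Lemma potential_cst T D : (0 < K)%N -> potential nu T (fun=> D) (fun n _ => n%:R * D).
Proof.
move=> K0; split=> [h _|n h hh hT]; first by rewrite mul0r.
exists (fun=> n%:R * D) => [b|]; first exact: has_mean_cst.
by rewrite -mulr_suml klms_policy_sum// mul1r -natr1 mulrDl mul1r addrC.
Qed.

(** At T = 1 there is no ln T to absorb constants, but the single pull is of the best arm. *)
Lemma klms_regret_horizon1 : (0 < K)%N ->
  (forall i j : 'I_K, (i <= j)%N -> mean nu j <= mean nu i) -> (klms_regret nu 1 <= 0)%E.
Proof.
move=> K0 srt; pose i0 := Ordinal K0.
have best : mu_best nu = mean nu i0 by apply: mu_bestE => i; exact: srt.
apply: (klms_regret_le 1 (fun _ _ => 0)) => //; split=> // n h hh hT.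
exists (fun=> 0) => [b|]; first exact: has_mean_cst.
have h0 : size h = 0%N by case: h hT {hh} => // z h; rewrite /= addnS.
apply: sumr_le0 => b _; rewrite addr0 /klms_policy h0 K0.
case: eqP => [b0|_]; last by rewrite mul0r.
have -> : b = i0 by apply: val_inj.
by rewrite best subrr mulr0.
Qed.

Lemma klms_regret_bound T : (2 <= K)%N ->
  (forall i j : 'I_K, (i <= j)%N -> mean nu j <= mean nu i) -> (1 <= T)%N ->
  (klms_regret nu T <=
    ((1 + 8 * (200 + 30 * 30 * 32 * 32 * expR 1)) *
      (Num.sqrt (mu_best nu * (1 - mu_best nu) * K%:R * T%:R * ln K%:R)
       + K%:R * ln T%:R))%:E)%E.
Proof.
move=> K2 srt T1; have K0 : (0 < K)%N by apply: leq_trans K2.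
set C0 : R := 200 + _; set rt := Num.sqrt _.
have C00 : 0 <= C0 by rewrite addr_ge0// mulr_ge0// expR_ge0.
have lT0 : 0 <= ln T%:R :> R by rewrite ln_ge0// ler1n.
have rt0 : 0 <= rt by exact: sqrtr_ge0.
have KT0 : 0 <= K%:R * ln T%:R :> R by rewrite mulr_ge0.
have [T2|T2] := leqP T 1.
  have -> : T = 1%N by apply/eqP; rewrite eqn_leq T2.
  apply: le_trans (klms_regret_horizon1 K0 srt) _; rewrite lee_fin.
  rewrite mulr_ge0 ?addr_ge0 ?mulr_ge0//.
  by rewrite ln1.
pose i0 := Ordinal K0.
have best : mu_best nu = mean nu i0 by apply: mu_bestE => i; exact: srt.
rewrite best in rt rt0 *.
have /andP[mu0 mu1] := mean_itv nu nu01 i0.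
set s := mean nu i0 * (1 - mean nu i0) in rt rt0 *.
have s0 : 0 <= s by rewrite mulr_ge0// subr_ge0.
have T0 : (0 : R) < T%:R by rewrite ltr0n.
have Kp : (0 : R) < K%:R by rewrite ltr0n.
have lK0 : 0 <= ln K%:R :> R by rewrite ln_ge0// ler1n.
(* Pulls of arms with gap at most [D] cost at most T D = [rt] altogether. *)
pose D := rt / T%:R.
have D0 : 0 <= D by rewrite divr_ge0// ltW.
have TD : T%:R * D = rt by rewrite /D mulrC divfK// gt_eqF.
have DE : D ^+ 2 * T%:R = s * K%:R * ln K%:R.
  have arg0 := mulr_ge0 (mulr_ge0 (mulr_ge0 s0 (ltW Kp)) (ltW T0)) lK0.
  by rewrite /D expr_div_n sqr_sqrtr//; field; rewrite gt_eqF.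
pose gap a := mean nu i0 - mean nu a.
pose w a := if D < gap a then gap a else 0.
have w0 a : 0 <= w a by rewrite /w; case: ltP => // /ltW; exact: le_trans.
have /choice[F FP] : forall a, exists F, 0 < w a -> potential nu T (fun b => (b == a)%:R) F /\
    w a * F T [::] <= C0 * (8 * (T%:R * D / K%:R) + 3 * ln T%:R).
  move=> a; rewrite /w; case: (ltP D (gap a)) => gD; last by exists (fun _ _ => 0); rewrite ltxx.
  have g0 : 0 < gap a by apply: le_lt_trans gD.
  have [F [F1 F2]] := arm_pulls_potential nu nu01 K0 T i0 a T1 g0.
  exists F => _; split => //.
  apply: le_trans (ler_wpM2l (ltW g0) F2) _.
  rewrite mulrCA ler_wpM2l//; apply: (arm_cost_le s _ _ _ _ _ s0 D0 gD) => //.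
  - have /andP[ma0 _] := mean_itv nu nu01 a; rewrite /gap; clear - ma0 mu1; lra.
  - by rewrite ler_nat.
  - by rewrite ler_nat.
(* A pull costs at most [D], plus the gap of its arm when that exceeds [D]. *)
have pot : potential nu T (fun b => mu_best nu - mean nu b)
    (fun n h => n%:R * D + \sum_a w a * F a n h).
  apply: (potential_le T _ (fun b => D + \sum_a w a * (b == a)%:R)) => //.
    move=> b; rewrite best -/(gap b) (bigD1 b)//= eqxx mulr1 big1 => [|a /negPf ab].
      by rewrite addr0 /w; case: (ltP D (gap b)) => gD; rewrite ?addr0// lerDr.
    by rewrite eq_sym ab mulr0.
  apply: potentialD; first exact: potential_cst.
  by apply: potential_sum => // a /FP[].
apply: le_trans (klms_regret_le T _ K0 pot) _; rewrite lee_fin TD.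
have : \sum_a w a * F a T [::] <= \sum_(a < K) C0 * (8 * (T%:R * D / K%:R) + 3 * ln T%:R).
  apply: ler_sum => a _; have [->|wa] := eqVneq (w a) 0.
    by rewrite mul0r mulr_ge0// addr_ge0// mulr_ge0// TD divr_ge0// ltW.
  by have [|] := FP a _; first by rewrite lt_def wa w0.
rewrite sumr_const card_ord -[_ *+ K]mulr_natl TD.
(* The share T D / K of each arm adds up to [rt] over the K arms. *)
have -> : K%:R * (C0 * (8 * (rt / K%:R) + 3 * ln T%:R)) =
    8 * (C0 * rt) + 3 * (C0 * (K%:R * ln T%:R)) by field; rewrite gt_eqF.
have := mulr_ge0 C00 KT0.
move: (\sum_a _) (K%:R * ln T%:R) KT0 rt0 => S X X0 rt0 CX hS.
have -> : (1 + 8 * C0) * (rt + X) = rt + X + 8 * (C0 * rt) + 8 * (C0 * X) by ring.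
move: (C0 * X) (C0 * rt) CX hS => cx cr; clear - X0; lra.
Qed.

End Regret.

Theorem theorem3 :
  exists C : Rdefinitions.R, 0 < C /\
  forall (K : nat) (nu : 'I_K -> probability (measurableTypeR Rdefinitions.R) Rdefinitions.R),
    (2 <= K)%N ->
    (forall a, nu a [set x : Rdefinitions.R | 0 <= x <= 1]%classic = 1%E) ->
    (forall i j : 'I_K, (i <= j)%N -> mean nu j <= mean nu i) ->
    forall T : nat, (1 <= T)%N ->
    (klms_regret nu T <=
      (C * (Num.sqrt (mu_best nu * (1 - mu_best nu) * K%:R * T%:R * ln K%:R)
            + K%:R * ln T%:R))%:E)%E.
Proof.
exists (1 + 8 * (200 + 30 * 30 * 32 * 32 * expR 1)); split.
  by rewrite ltr_pwDl// mulr_ge0// addr_ge0// mulr_ge0// expR_ge0.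
by move=> K nu K2 nu01 srt T T1; exact: klms_regret_bound.
Qed.
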